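(* Let $n>2$, let $K\subset\mathbb{R}^{n,+}$ be a bounded region with smooth boundary whose closure $\overline K$ lies in $\mathbb{R}^{n,+}$, and let $L\in C^1(\overline K)$ be $Cl_n$-valued. Define, for $y\in\mathbb{R}^{n,+}\setminus\overline K$, $$I(y)=y_n^{n-2}\left(\int_K E(x,y)L(x)\,dx^n-\int_K F(x,y)\hat L(x)\,dx^n\right).$$ Then $I$ is hypermonogenic on $\mathbb{R}^{n,+}\setminus\overline K$, i.e. $MI=0$ there.
   Context: $Cl_n$ is the real Clifford algebra generated by an orthonormal basis $e_1,\dots,e_n$ of $\mathbb{R}^n$ with $e_ie_j+e_je_i=-2\delta_{ij}$; vectors $x=\sum x_je_j$ are viewed in $Cl_n$, a nonzero vector has inverse $x^{-1}=-x/\|x\|^2$, $\|\cdot\|$ is the Euclidean norm, $\mathbb{R}^{n,+}=\{x:x_n>0\}$, and $dx^n$ is Lebesgue measure. $Cl_{n-1}$ is the subalgebra generated by $e_1,\dots,e_{n-1}$; each $A\in Cl_n$ is uniquely $A=B+Ce_n$ with $B,C\in Cl_{n-1}$, and $\hat A:=B-Ce_n$, $Q(A)=C$, $Q'(A)=-e_nQ(A)e_n$. For a vector $y$, $\hat y=y_1e_1+\dots+y_{n-1}e_{n-1}-y_ne_n$; $\hat L(x)=\widehat{L(x)}$. The kernels are $E(x,y)=\frac{(x-y)^{-1}}{\|x-y\|^{n-2}\|x-\hat y\|^{n-2}}$ and $F(x,y)=\frac{(\hat x-y)^{-1}}{\|x-y\|^{n-2}\|\hat x-y\|^{n-2}}$.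 The Dirac-Hodge operator is $Mf=\sum_{j=1}^ne_j\frac{\partial f}{\partial y_j}+\frac{n-2}{y_n}Q'(f)$, and $f$ is (left) hypermonogenic if $Mf=0$. *)

(* Defs.v *)
From HB Require Import structures.
From mathcomp Require Import all_boot all_order all_algebra.
From mathcomp Require Import all_classical all_reals all_analysis.
Set Implicit Arguments. Unset Strict Implicit. Unset Printing Implicit Defensive.
Import Order.TTheory GRing.Theory Num.Theory.
Import numFieldNormedType.Exports.
Local Open Scope classical_set_scope.
Local Open Scope ring_scope.

Section Clifford.
Variables (R : realType) (n : nat).

(** Points of R^n are row vectors; coordinates are 0-based, so the paper's
    x_n is the coordinate with index n.-1. *)
Definition pointn := 'rV[R]_n.

Definition coordn (x : pointn) (k : nat) : R :=
  oapp (fun i : 'I_n => x 0 i) 0 (insub k).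

Definition lastc (x : pointn) : R := coordn x n.-1.

Definition enorm (x : pointn) : R := Num.sqrt (\sum_(i < n) x 0 i ^+ 2).

Definition hatv (x : pointn) : pointn :=
  \row_(i < n) (if val i == n.-1 then - x 0 i else x 0 i).

Definition edir (j : 'I_n) : pointn := delta_mx 0 j.

(** The Clifford algebra Cl_n: coefficients on the basis e_A, A a subset of
    {0..n-1}, e_A = e_{a_1}...e_{a_k} with a_1 < ... < a_k. *)
Definition Cl := {ffun {set 'I_n} -> R}.

Definition clbasis (A : {set 'I_n}) : Cl := [ffun B => if B == A then 1 else 0].

(** sign of e_A e_B = sign * e_(A Δ B), using e_i e_j = - e_j e_i (i<>j),
    e_i^2 = -1 *)
Definition clsign (A B : {set 'I_n}) : R :=
  (-1) ^+ (#|[set p : 'I_n * 'I_n | (p.1 \in A) && (p.2 \in B) && ((val p.2 < val p.1)%N)]|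
           + #|A :&: B|)%N.

Definition clmul (a b : Cl) : Cl :=
  [ffun C => \sum_(A : {set 'I_n}) \sum_(B : {set 'I_n} | (A :\: B) :|: (B :\: A) == C)
               clsign A B * a A * b B].

Definition clvec (x : pointn) : Cl :=
  [ffun A => \sum_(i < n) (if A == [set i]%SET then x 0 i else 0)].

Definition vinv (x : pointn) : Cl := (- (enorm x ^+ 2)^-1) *: clvec x.

Definition lastset : {set 'I_n} := [set i | val i == n.-1]%SET.

Definition e_n : Cl := clbasis lastset.

(** A = B + C e_n with B, C in Cl_{n-1}; hat A = B - C e_n *)
Definition hatc (a : Cl) : Cl :=
  [ffun A : {set 'I_n} => if [disjoint A & lastset] then a A else - a A].

(** Q(A) = C  (note e_S e_n = e_(S u {n}) for S in Cl_{n-1}) *)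
Definition Qc (a : Cl) : Cl :=
  [ffun S : {set 'I_n} => if [disjoint S & lastset] then a (S :|: lastset) else 0].

Definition Qp (a : Cl) : Cl := - clmul (clmul e_n (Qc a)) e_n.

Definition kerE (x y : pointn) : Cl :=
  ((enorm (x - y) ^+ (n - 2) * enorm (x - hatv y) ^+ (n - 2))^-1) *: vinv (x - y).

Definition kerF (x y : pointn) : Cl :=
  ((enorm (x - y) ^+ (n - 2) * enorm (hatv x - y) ^+ (n - 2))^-1) *: vinv (hatv x - y).

Definition pderiv (f : pointn -> Cl) (j : 'I_n) (y : pointn) : Cl :=
  [ffun A => 'D_(edir j) (fun z => f z A) y].

Definition Mop (f : pointn -> Cl) (y : pointn) : Cl :=
  \sum_(j < n) clmul (clvec (edir j)) (pderiv f j y)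
  + ((n%:R - 2) / lastc y) *: Qp (f y).

Fixpoint Ck (k : nat) (U : set pointn) (f : pointn -> R) : Prop :=
  (forall x, U x -> {for x, continuous f}) /\
  match k with
  | 0 => True
  | k'.+1 => forall j : 'I_n, (forall x, U x -> derivable f x (edir j)) /\
                            Ck k' U (fun x => 'D_(edir j) f x)
  end.

Definition smooth_on (U : set pointn) (f : pointn -> R) : Prop := forall k, Ck k U f.

Definition smooth_bounded_region (K : set pointn) : Prop :=
  [/\ open K, K !=set0, connected K, bounded_set K &
   forall p, closure K p -> ~ K p ->
     exists U : set pointn, exists phi : pointn -> R,
       [/\ open U, U p, smooth_on U phi,
           (forall x, U x -> exists j : 'I_n, 'D_(edir j) phi x != 0) &
           (forall x, U x -> (K x <-> phi x < 0))]].

Definition C1_closure (K : set pointn) (L : pointn -> Cl) : Prop :=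
  forall A : {set 'I_n},
    {within closure K, continuous (fun x => L x A)} /\
    forall j : 'I_n,
      (forall x, K x -> derivable (fun z => L z A) x (edir j)) /\
      exists g : pointn -> R, {within closure K, continuous g} /\
        (forall x, K x -> 'D_(edir j) (fun z => L z A) x = g x).

(** Lebesgue integral over R^n, computed as an iterated integral over the
    coordinates (Fubini); coordinates are given as a sequence nat -> R *)
Fixpoint iint (k : nat) (g : (nat -> R) -> R) : R :=
  match k with
  | 0 => g (fun _ => 0)
  | k'.+1 => iint k' (fun c =>
       \int[@lebesgue_measure R]_(t in [set: R]) g (fun m => if m == k' then t else c m))
  end.

Definition pt (c : nat -> R) : pointn := \row_(i < n) c (val i).

Definition clint (K : set pointn) (f : pointn -> Cl) : Cl :=
  [ffun A => iint n (fun c => \1_K (pt c) * f (pt c) A)].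

Definition Ifun (K : set pointn) (L : pointn -> Cl) (y : pointn) : Cl :=
  lastc y ^+ (n - 2) *:
    (clint K (fun x => clmul (kerE x y) (L x))
     - clint K (fun x => clmul (kerF x y) (hatc (L x)))).

Definition hypermonogenic (U : set pointn) (f : pointn -> Cl) : Prop :=
  (forall A : {set 'I_n}, Ck 1 U (fun z => f z A)) /\
  (forall y, U y -> Mop f y = 0).

End Clifford.

(* Main.v *)
Require Import Defs.
From HB Require Import structures.
From mathcomp Require Import all_boot all_order all_algebra.
From mathcomp Require Import all_classical all_reals all_analysis.
From mathcomp Require Import measurable_realfun ring lra.
Import Order.TTheory GRing.Theory Num.Theory.
Import numFieldNormedType.Exports.
Local Open Scope classical_set_scope.
Local Open Scope ring_scope.

(** With the factor y_n^(n-2) moved under the integrals, I is a superposition of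
    kernels which, for each fixed x and a = L(x), read
      rho(x,y) (u a - v (hat a)),   u = (x - y)^(-1),  v = (hat x - y)^(-1),
      rho = (y_n / (|x-y| |hat x - y|))^(n-2).
    The logarithmic gradient of rho is (n-2)(e_n/y_n - u - v) and D u = -(n-2)/|x-y|^2,
    so D(rho u a) = (n-2) rho (e_n u a / y_n - v u a), and symmetrically for v.  Together
    with Q'(b) = -e_n (b - hat b)/2 this makes M vanish on the kernel, because
    u - hat v = 2 y_n (hat v) e_n u  and  e_n (hat v) e_n = v.
    For fixed y off the closure of K the kernels are continuous on that compact set, so
    differentiation under the integral is uniform approximation plus boundedness of the
    iterated integral as a linear functional on bounded continuous integrands. *)

(** * Left multiplication by vectors in Cl_n *)

(** On the analytic side the obstacle is that [iint] nests one-dimensional integrals. A partial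
    integral is a new function of the remaining coordinates, and linearity at the next stage
    requires that function to be measurable and integrable again. Continuity of the integrand on [K]
    is not inherited in a usable form, because the indicator of [K] jumps at the boundary. Since [K]
    is open, however, the extension by zero of a nonnegative continuous function is lower
    semicontinuous, and that property does survive partial integration. On the algebraic side every
    product is a left multiplication by a vector, so a single relation, u w + w u = -2 <u,w>,
    governs the computation. The right factor e_n in Q' is absorbed by the hat map, which makes Q'
    one more linear operator that commutes with the integral. Both kernels carry the same real
    weight because |x - hat y| = |hat x - y|. Their singularities x and hat x are avoided for
    different reasons: y lies off the closure of K, and hat x lies in the lower half-space. *)

Section CliffordAction.
Context {R : realType} {n : nat}.
Implicit Types (i j l : 'I_n) (A B C : {set 'I_n}) (u w : pointn R n) (a b : Cl R n).

Lemma clDE a b C : (a + b) C = a C + b C.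
Proof. by rewrite ffunE. Qed.

Lemma clNE a C : (- a) C = - a C.
Proof. by rewrite ffunE. Qed.

Lemma clZE k a C : (k *: a) C = k * a C.
Proof. by rewrite ffunE. Qed.

Definition symdiff A B : {set 'I_n} := ((A :\: B) :|: (B :\: A))%SET.

Lemma in_symdiff A B i : (i \in symdiff A B) = (i \in A) (+) (i \in B).
Proof. by rewrite !inE; case: (i \in A); case: (i \in B). Qed.

Lemma symdiffK A B : symdiff A (symdiff A B) = B.
Proof.
by apply/setP => i; rewrite !in_symdiff; case: (i \in A); case: (i \in B).
Qed.

Lemma symdiffC A B : symdiff A B = symdiff B A.
Proof. by apply/setP => i; rewrite !in_symdiff addbC. Qed.

Lemma symdiff_eq A B C : (symdiff A B == C) = (B == symdiff A C).
Proof. by apply/eqP/eqP => [<-|->]; rewrite symdiffK. Qed.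

(** Up to sign, left multiplication by e_i carries the basis index [C] to [toggle i C]. *)
Definition toggle i C := symdiff [set i]%SET C.

Lemma in_toggle i j C : (j \in toggle i C) = (j == i) (+) (j \in C).
Proof. by rewrite in_symdiff inE. Qed.

Lemma toggleK i C : toggle i (toggle i C) = C.
Proof. exact: symdiffK. Qed.

Lemma toggleC i j C : toggle i (toggle j C) = toggle j (toggle i C).
Proof.
by apply/setP => k; rewrite !in_toggle; case: eqP; case: eqP; case: (k \in C).
Qed.

Lemma odd_card_toggle i C : odd #|toggle i C| = ~~ odd #|C|.
Proof.
have [iC|niC] := boolP (i \in C).
  have -> : toggle i C = (C :\ i)%SET.
    by apply/setP => k; rewrite in_toggle !inE; case: eqP => [->|]; rewrite ?iC.
  by rewrite (cardsD1 i C) iC /= negbK.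
have -> : toggle i C = (i |: C)%SET.
  by apply/setP => k; rewrite in_toggle !inE; case: eqP => [->|]; rewrite ?(negbTE niC).
by rewrite cardsU1 niC.
Qed.

Definition below j C : {set 'I_n} := [set b in C | (val b < val j)%N]%SET.

Lemma in_below j C i : (i \in below j C) = (i \in C) && (val i < val j)%N.
Proof. by rewrite finset.in_set. Qed.

Lemma odd_below_toggle i j C :
  odd #|below j (toggle i C)| = (val i < val j)%N (+) odd #|below j C|.
Proof.
have [ij|ij] := boolP (val i < val j)%N.
  rewrite addTb -(odd_card_toggle i); congr (odd #|pred_of_set _|).
  apply/setP => k; rewrite in_toggle !in_below in_toggle.
  by case: eqP => [->|] //=; rewrite ij !andbT.
congr (odd #|pred_of_set _|); apply/setP => k; rewrite !in_below in_toggle.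
by case: eqP => [->|] //=; rewrite (negbTE ij) !andbF.
Qed.

(** The sign in e_j e_(toggle j C) = [esign j C] e_C: one factor -1 for each generator below j that
    e_j has to pass, and one more from e_j^2 = -1, which occurs when j lies in [toggle j C], that
    is, outside [C]. *)
Definition esign j C : R := (-1) ^+ (#|below j C| + (j \notin C)).

Lemma esign_odd j C : esign j C = (-1) ^+ (odd #|below j C| (+) (j \notin C)).
Proof. by rewrite /esign -signr_odd oddD oddb. Qed.

(** The relation e_i e_j + e_j e_i = -2 delta_ij in coefficients. Toggling i changes the parity of
    [below j C] exactly when i < j, so for distinct i and j exactly one of the two orders acquires
    an extra sign and the terms cancel. *)
Lemma esign_anticomm i j C :
  esign i C * esign j (toggle i C) + esign j C * esign i (toggle j C) =
  - (if i == j then 2 else 0).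
Proof.
rewrite !esign_odd !odd_below_toggle !in_toggle -!signr_addb.
case: (eqVneq i j) => [<-|ij].
  rewrite ?eqxx ltnn /=; case: (odd _); case: (i \in C) => /=; ring.
have ji : (val j < val i)%N = ~~ (val i < val j)%N.
  by rewrite -leqNgt ltn_neqAle val_eqE eq_sym ij.
rewrite ji.
case: (val i < val j)%N; case: (odd #|below i C|); case: (odd #|below j C|);
  case: (i \in C); case: (j \in C) => /=; ring.
Qed.

Definition vmul w a : Cl R n :=
  [ffun C => \sum_(i < n) w 0 i * esign i C * a (toggle i C)].

Lemma clsign_toggle i C : clsign R [set i]%SET (toggle i C) = esign i C.
Proof.
rewrite /clsign /esign; congr (_ ^+ (_ + _)).
  have -> : below i C = below i (toggle i C).
    by apply/setP => k; rewrite !in_below in_toggle; case: eqP => // ->; rewrite ltnn !andbF.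
  rewrite -(card_imset (below i (toggle i C)) (f := fun k => (i, k))); last first.
    by move=> x y [].
  apply: eq_card => -[p q]; apply/idP/imsetP => [|[k kC [-> ->]]].
    rewrite in_setE /= => /andP[/andP[/set1P -> qC] qi]; exists q => //.
    by rewrite in_below qC.
  by move: kC; rewrite in_below in_setE /= set11.
have [iC|niC] := boolP (i \in C); last first.
  rewrite (_ : _ :&: _ = [set i])%SET ?cards1//; apply/setP => k.
  rewrite !inE; case: eqP => //= ->; by rewrite niC.
rewrite (_ : _ :&: _ = finset.set0)%SET ?cards0//; apply/setP => k.
by rewrite !inE; case: eqP => //= ->; rewrite iC.
Qed.

(** Given [A] and [C], the inner index is forced to be [symdiff A C], and [clvec w] lives on
    singletons. The double sum over subsets therefore shrinks to one sum over generators. *)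
Lemma clmul_vec w a : clmul (clvec w) a = vmul w a.
Proof.
apply/ffunP => C; rewrite !ffunE.
transitivity (\sum_A clsign R A (symdiff A C) * clvec w A * a (symdiff A C)).
  apply: eq_bigr => A _; rewrite (big_pred1 (symdiff A C))// => B.
  exact: symdiff_eq.
transitivity (\sum_A \sum_(i < n) (if A == [set i]%SET then
    w 0 i * esign i C * a (toggle i C) else 0)).
  apply: eq_bigr => A _; rewrite ffunE mulrAC mulr_sumr; apply: eq_bigr => i _.
  case: eqP => [->|]; last by rewrite mulr0.
  by rewrite clsign_toggle; ring.
rewrite exchange_big /=; apply: eq_bigr => i _.
by rewrite -big_mkcond /= (big_pred1 [set i]%SET).
Qed.

Lemma vmulDr w a b : vmul w (a + b) = vmul w a + vmul w b.
Proof.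
apply/ffunP => C; rewrite !ffunE -big_split /=; apply: eq_bigr => i _.
by rewrite ffunE mulrDr.
Qed.

Lemma vmulZr w k a : vmul w (k *: a) = k *: vmul w a.
Proof.
apply/ffunP => C; rewrite !ffunE /GRing.scale /= mulr_sumr; apply: eq_bigr => i _.
by rewrite ffunE /GRing.scale /=; ring.
Qed.

Lemma vmulDl u w a : vmul (u + w) a = vmul u a + vmul w a.
Proof.
apply/ffunP => C; rewrite !ffunE -big_split /=; apply: eq_bigr => i _.
by rewrite !mxE; ring.
Qed.

Lemma vmulZl k w a : vmul (k *: w) a = k *: vmul w a.
Proof.
apply/ffunP => C; rewrite !ffunE /GRing.scale /= mulr_sumr; apply: eq_bigr => i _.
by rewrite !mxE; ring.
Qed.

Lemma vmulNr w a : vmul w (- a) = - vmul w a.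
Proof. by rewrite -scaleN1r vmulZr scaleN1r. Qed.

Lemma vmulNl w a : vmul (- w) a = - vmul w a.
Proof. by rewrite -scaleN1r vmulZl scaleN1r. Qed.

Lemma vmulBr w a b : vmul w (a - b) = vmul w a - vmul w b.
Proof. by rewrite vmulDr vmulNr. Qed.

Lemma vmulBl u w a : vmul (u - w) a = vmul u a - vmul w a.
Proof. by rewrite vmulDl vmulNl. Qed.

Lemma vmul0r w : vmul w 0 = 0.
Proof. by rewrite -[X in vmul w X](subrr 0) vmulBr subrr. Qed.

Lemma vmul0l a : vmul 0 a = 0.
Proof. by rewrite -[X in vmul X a](subrr 0) vmulBl subrr. Qed.

Lemma vmul_suml (I : finType) (f : I -> pointn R n) a :
  vmul (\sum_i f i) a = \sum_i vmul (f i) a.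
Proof.
exact: (big_morph (vmul^~ a) (fun u w => vmulDl u w a) (vmul0l a)).
Qed.

Lemma row_sum_edir w : w = \sum_i w 0 i *: edir R i.
Proof. exact: row_sum_delta. Qed.

Definition dot u w : R := \sum_(i < n) u 0 i * w 0 i.

Lemma vmul_anticomm u w a :
  vmul u (vmul w a) + vmul w (vmul u a) = (- (2 * dot u w)) *: a.
Proof.
apply/ffunP => C; rewrite !ffunE /=.
pose T (x y : pointn R n) i j := x 0 i * y 0 j * (esign i C * esign j (toggle i C))
                    * a (toggle j (toggle i C)).
have E (x y : pointn R n) : \sum_(i < n) x 0 i * esign i C * vmul y a (toggle i C) =
             \sum_(i < n) \sum_(j < n) T x y i j.
  apply: eq_bigr => i _; rewrite ffunE mulr_sumr; apply: eq_bigr => j _.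
  by rewrite /T; ring.
(* Exchanging the second double sum pairs its (j,i) term with the (i,j) term of the first:
   off-diagonal pairs cancel and the diagonal leaves the dot product. *)
rewrite !E (exchange_big _ _ _ _ _ (T w u)) -big_split /=.
rewrite /dot -mulNr mulr_sumr /GRing.scale /= mulr_suml; apply: eq_bigr => i _.
rewrite -big_split /= (bigD1 i)//= big1 ?addr0 => [|j ji].
  have : esign i C * esign i (toggle i C) = -1.
    by have := esign_anticomm i i C; rewrite eqxx; lra.
  by rewrite /T toggleK => ->; ring.
have : esign i C * esign j (toggle i C) = - (esign j C * esign i (toggle j C)).
  by apply/eqP; rewrite -subr_eq0 opprK esign_anticomm (eq_sym i) (negbTE ji) oppr0.
by rewrite /T (toggleC j i) => ->; ring.
Qed.

Lemma vmul_sq w a : vmul w (vmul w a) = (- dot w w) *: a.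
Proof.
have := vmul_anticomm w w a.
rewrite -mulr2n -scaler_nat => /(congr1 (fun x => 2^-1 *: x)).
rewrite !scalerA mulVf ?pnatr_eq0// scale1r => ->.
by rewrite mulrN mulKf ?pnatr_eq0.
Qed.

Lemma lastset_set1 l : val l = n.-1 -> lastset n = [set l]%SET.
Proof. by move=> e; apply/setP => i; rewrite !inE -e. Qed.

Lemma disjoint_set1 l A : [disjoint A & [set l]%SET]%B = (l \notin A).
Proof. by rewrite disjoint_sym disjoints1. Qed.

Lemma hatcE l a C : val l = n.-1 -> hatc a C = (-1) ^+ (l \in C) * a C.
Proof.
move=> /lastset_set1 e; rewrite ffunE e disjoint_set1.
by case: (l \in C); rewrite ?expr0 ?expr1 ?mul1r ?mulN1r.
Qed.

Lemma hatvE l w i : val l = n.-1 -> hatv w 0 i = (-1) ^+ (l == i) * w 0 i.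
Proof.
move=> e; rewrite mxE -e eq_sym -val_eqE.
by case: eqP; rewrite ?expr0 ?expr1 ?mul1r ?mulN1r.
Qed.

(** The hat map is the algebra automorphism that fixes the other generators and negates e_n; this is
    its multiplicativity for a left vector factor. *)
Lemma hatc_vmul l w a : val l = n.-1 ->
  hatc (vmul w a) = vmul (hatv w) (hatc a).
Proof.
move=> e; apply/ffunP => C; rewrite (hatcE _ _ _ e) !ffunE mulr_sumr.
apply: eq_bigr => i _; rewrite (hatvE _ _ _ e) (hatcE _ _ _ e) in_toggle.
by case: (l == i); case: (l \in C) => /=; ring.
Qed.

Lemma hatcZ l k a : val l = n.-1 -> hatc (k *: a) = k *: hatc a.
Proof.
move=> e; apply/ffunP => C.
by rewrite clZE !(hatcE _ _ _ e) clZE; ring.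
Qed.

Lemma hatcB l a b : val l = n.-1 -> hatc (a - b) = hatc a - hatc b.
Proof.
move=> e; apply/ffunP => C.
by rewrite !(clDE, clNE, hatcE _ _ _ e); ring.
Qed.

Lemma hatcK a : hatc (hatc a) = a.
Proof. by apply/ffunP => C; rewrite !ffunE; case: ifP => h; rewrite ?h ?opprK. Qed.

Lemma hatvK w : hatv (hatv w) = w.
Proof. by apply/rowP => i; rewrite !mxE; case: ifP => h; rewrite ?h ?opprK. Qed.

Lemma clvec_edir l : clvec (edir R l) = clbasis R [set l]%SET.
Proof.
apply/ffunP => A; rewrite !ffunE (bigD1 l)//= big1 => [|i il].
  by rewrite addr0 mxE !eqxx.
by rewrite mxE eqxx (negbTE il); case: ifP.
Qed.

(** Since l is the largest index, e_A e_l is already in increasing order, and the only possible sign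
    comes from e_l^2 = -1. *)
Lemma clmul_basisr l a : val l = n.-1 ->
  clmul a (clbasis R [set l]%SET) =
  [ffun C : {set 'I_n} => (-1) ^+ (l \notin C) * a (toggle l C)].
Proof.
move=> e; apply/ffunP => C; rewrite !ffunE.
have tE A : (symdiff A C == [set l]%SET) = (A == toggle l C).
  by rewrite (symdiffC A) symdiff_eq (symdiffC C).
transitivity (\sum_A if A == toggle l C then clsign R A [set l]%SET * a A else 0).
  apply: eq_bigr => A _; rewrite (big_pred1 (symdiff A C)) => [|B].
    by rewrite ffunE tE; case: eqP => [->|_]; rewrite ?mulr0// symdiffC /toggle
      (symdiffC [set l]%SET) symdiffK mulr1.
  exact: symdiff_eq.
rewrite -big_mkcond big_pred1_eq /clsign; congr (_ ^+ _ * _).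
transitivity (0 + (l \notin C))%N => //; congr addn.
  apply: eq_card0 => -[p q].
  apply/negbTE/negP => /set_mem /= /andP[/andP[_ /set1P ->]] lp.
  by have := ltn_ord p; rewrite -[X in (_ < X)%N -> _](ltn_predK (ltn_ord l)) -e ltnS leqNgt lp.
have [iC|niC] := boolP (l \in C).
  rewrite (_ : _ :&: _ = finset.set0)%SET ?cards0//; apply/setP => k.
  by rewrite !inE; case: eqP => //= [->|]; rewrite ?iC ?andbF.
rewrite (_ : _ :&: _ = [set l])%SET ?cards1//; apply/setP => k.
by rewrite !inE; case: eqP => //= [->|]; rewrite ?andbF ?(negbTE niC).
Qed.

(* This is Q'(a) = - e_n (Q(a) e_n), since a - hat a = 2 Q(a) e_n. *)
Lemma QpE l a : val l = n.-1 ->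
  Qp a = (- 2^-1) *: vmul (edir R l) (a - hatc a).
Proof.
move=> e; rewrite /Qp /e_n (lastset_set1 _ e) -clvec_edir clmul_vec clvec_edir.
rewrite clmul_basisr//.
have vE b C : vmul (edir R l) b C = esign l C * b (toggle l C).
  rewrite ffunE (bigD1 l)//= big1 ?addr0 => [|i il].
    by rewrite mxE !eqxx mul1r.
  by rewrite mxE (negbTE il) andbF !mul0r.
apply/ffunP => C; rewrite clNE clZE ffunE !vE toggleK clDE clNE (hatcE _ _ _ e).
rewrite ffunE (lastset_set1 _ e) disjoint_set1 in_toggle eqxx /=.
have [lC|lC] := boolP (l \in C) => /=; first by ring.
have -> : (C :|: [set l])%SET = toggle l C.
  apply/setP => k; rewrite in_toggle finset.in_setU finset.in_set1.
  by case: eqP => [->|_]; rewrite ?(negbTE lC) ?orbT ?orbF.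
rewrite !esign_odd odd_below_toggle ltnn /= in_toggle eqxx (negbTE lC) /=.
by case: (odd _) => /=; field.
Qed.

End CliffordAction.

(** * The Dirac-Hodge operator applied to the kernels *)

Section DiracIdentity.
Context {R : realType} {n : nat}.
Variable l : 'I_n.
Hypothesis lE : val l = n.-1.
Implicit Types (i j : 'I_n) (u w X V Z : pointn R n) (a b : Cl R n).

Local Notation e := (edir R l).

Lemma edirE i j : edir R i 0 j = (j == i)%:R.
Proof. by rewrite mxE eqxx. Qed.

Lemma dotC u w : dot u w = dot w u.
Proof. by apply: eq_bigr => i _; rewrite mulrC. Qed.

Lemma dotZl k u w : dot (k *: u) w = k * dot u w.
Proof. by rewrite /dot mulr_sumr; apply: eq_bigr => i _; rewrite mxE mulrA. Qed.

Lemma dot_edir i w : dot (edir R i) w = w 0 i.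
Proof.
rewrite /dot (bigD1 i)//= big1 ?addr0 => [|j ji]; rewrite edirE.
  by rewrite eqxx mul1r.
by rewrite (negbTE ji) mul0r.
Qed.

Lemma dot_hatv w : dot (hatv w) (hatv w) = dot w w.
Proof. by apply: eq_bigr => i _; rewrite !mxE; case: ifP; rewrite ?mulrNN. Qed.

Lemma hatvB u w : hatv (u - w) = hatv u - hatv w.
Proof. by apply/rowP => i; rewrite !mxE; case: ifP => _; rewrite ?opprD. Qed.

Lemma hatvZ k w : hatv (k *: w) = k *: hatv w.
Proof. by apply/rowP => i; rewrite !mxE; case: ifP; rewrite ?mulrN. Qed.

Lemma hatv_edir : hatv e = - e.
Proof.
apply/rowP => i; rewrite (hatvE _ _ _ lE) [RHS]mxE !edirE eq_sym.
by case: eqP => _ /=; ring.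
Qed.

(** Conjugation by e_n is the reflection: w e = -2 w_n - e w and e e = -1 give e w e = w - 2 w_n
    e. *)
Lemma vmul_conj_edir w a : vmul e (vmul w (vmul e a)) = vmul (hatv w) a.
Proof.
have -> : vmul w (vmul e a) = (- (2 * w 0 l)) *: a - vmul e (vmul w a).
  by rewrite -(dot_edir l w) -vmul_anticomm addrAC subrr add0r.
rewrite vmulBr vmulZr vmul_sq dot_edir edirE eqxx scaleN1r opprK -vmulZl -vmulDl.
congr vmul; apply/rowP => i; rewrite (hatvE _ _ _ lE) !mxE eqxx eq_sym /=.
by case: eqP => [->|_] /=; ring.
Qed.

(* With Z = hat V: T X - S Z = Z (X - Z) X, and e Z e = V. *)
Lemma vmul_inversion_diff X V h a :
  X - hatv V = (2 * h) *: e -> dot X X != 0 -> dot V V != 0 ->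
  vmul e (vmul ((dot X X)^-1 *: X - hatv ((dot V V)^-1 *: V)) a) =
  (2 * h) *: vmul ((dot V V)^-1 *: V) (vmul ((dot X X)^-1 *: X) a).
Proof.
move=> XV S0 T0; set S := dot X X; set T := dot V V.
have key : T *: vmul X a - S *: vmul (hatv V) a =
    (2 * h) *: vmul (hatv V) (vmul e (vmul X a)).
  rewrite -[RHS]vmulZr -[X in _ = vmul _ X]vmulZl -XV vmulBl vmulBr vmul_sq vmul_sq dot_hatv -/S -/T.
  by rewrite vmulZr !scaleNr opprK addrC.
rewrite vmulBl hatvZ !vmulZl.
have -> : S^-1 *: vmul X a - T^-1 *: vmul (hatv V) a =
    (S^-1 * T^-1) *: (T *: vmul X a - S *: vmul (hatv V) a).
  rewrite scalerBr !scalerA mulfVK// mulrAC mulVf// mul1r.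
  by [].
rewrite key !vmulZr vmul_conj_edir hatvK !scalerA; congr (_ *: _); ring.
Qed.

(** The hypothesis is symmetric under exchanging [X] and [V], so the inversion identity applies once
    to [a] and once to [hatc a]. For b = u a - v (hat a), adding Q'(b) to e b leaves e (b + hat b) /
    2, and b + hat b regroups as (u - hat v) a - (v - hat u) (hat a). *)
Lemma Qp_inversion_diff X V h a :
  X - hatv V = (2 * h) *: e -> dot X X != 0 -> dot V V != 0 ->
  let u := (dot X X)^-1 *: X in let v := (dot V V)^-1 *: V in
  vmul e (vmul u a - vmul v (hatc a)) + Qp (vmul u a - vmul v (hatc a)) =
  h *: vmul v (vmul u a) - h *: vmul u (vmul v (hatc a)).
Proof.
move=> XV S0 T0 u v.
have VX : V - hatv X = (2 * h) *: e.
  rewrite -[V]hatvK -hatvB -opprB XV -scalerN hatvZ.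
  rewrite (_ : hatv (- e) = e)//.
  by rewrite -hatv_edir hatvK.
have := vmul_inversion_diff X V h a XV S0 T0.
have := vmul_inversion_diff V X h (hatc a) VX T0 S0.
rewrite -/u -/v => F E.
have -> : h *: vmul v (vmul u a) = 2^-1 *: vmul e (vmul (u - hatv v) a).
  by rewrite E scalerA mulKf ?pnatr_eq0.
have -> : h *: vmul u (vmul v (hatc a)) = 2^-1 *: vmul e (vmul (v - hatv u) (hatc a)).
  by rewrite F scalerA mulKf ?pnatr_eq0.
rewrite (QpE l)// -vmulZr -vmulDr -!vmulZr -vmulBr; congr vmul.
rewrite (hatcB l)// !(hatc_vmul l)// hatcK !vmulBl !vmulZr.
by apply/ffunP => C; rewrite !(clDE, clNE, clZE); field.
Qed.

(** The bracket is the j-th derivative of a weighted inversion field divided by its weight: [W] is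
    the logarithmic gradient of the weight, and delta_ij s - 2 u_i u_j is the Jacobian of X / |X|^2.
    The delta term contributes the sum of the e_j e_j, that is -n s, and the last term contributes
    -2 u u = 2 s. *)
Lemma dirac_kernel (W u : pointn R n) s a : dot u u = s ->
  \sum_(j < n) vmul (edir R j)
    (\sum_(i < n) (W 0 j * u 0 i + (i == j)%:R * s - 2 * (u 0 i * u 0 j))
       *: vmul (edir R i) a) =
  vmul W (vmul u a) + ((2 - n%:R) * s) *: a.
Proof.
move=> us.
transitivity (\sum_(j < n) (vmul (W 0 j *: edir R j) (vmul u a)
   + (- s) *: a - 2 *: vmul (u 0 j *: edir R j) (vmul u a))).
  apply: eq_bigr => j _.
  have -> : \sum_(i < n) (W 0 j * u 0 i + (i == j)%:R * s - 2 * (u 0 i * u 0 j))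
       *: vmul (edir R i) a =
    W 0 j *: vmul u a + s *: vmul (edir R j) a - 2 *: (u 0 j *: vmul u a).
    have uE : vmul u a = \sum_i u 0 i *: vmul (edir R i) a.
      rewrite {1}(row_sum_edir u) vmul_suml; apply: eq_bigr => i _.
      by rewrite vmulZl.
    have sE : s *: vmul (edir R j) a =
        \sum_(i < n) ((i == j)%:R * s) *: vmul (edir R i) a.
      rewrite (bigD1 j)//= big1 ?addr0 ?eqxx ?mul1r// => i /negbTE ->.
      by rewrite mul0r scale0r.
    rewrite uE sE !scaler_sumr -sumrN -!big_split /=; apply: eq_bigr => i _.
    by apply/ffunP => C; rewrite !(clDE, clNE, clZE); ring.
  rewrite vmulBr vmulDr !vmulZr vmul_sq dot_edir edirE eqxx !vmulZl.
  by apply/ffunP => C; rewrite !(clDE, clNE, clZE) /=; ring.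
rewrite !big_split /= sumrN -!scaler_sumr -!vmul_suml -!row_sum_edir.
rewrite vmul_sq us sumr_const card_ord -addrA; congr (_ + _).
by rewrite -scaler_nat; apply/ffunP => C; rewrite !(clDE, clNE, clZE); ring.
Qed.

(** Since u u = -|u|^2, the -u part of [W] cancels the scalar term of [dirac_kernel], and likewise
    for v. What remains is (n-2) rho / h times the identity [Qp_inversion_diff]. *)
Lemma dirac_hodge_kernel X V h rho a (u := (dot X X)^-1 *: X)
    (v := (dot V V)^-1 *: V) (W := (n%:R - 2) *: (h^-1 *: e - u - v)) :
  X - hatv V = (2 * h) *: e -> dot X X != 0 -> dot V V != 0 -> h != 0 ->
  \sum_(j < n) vmul (edir R j)
   (\sum_(i < n) (rho * (W 0 j * u 0 i + (i == j)%:R * (dot X X)^-1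
       - 2 * (u 0 i * u 0 j))) *: vmul (edir R i) a
  - \sum_(i < n) (rho * (W 0 j * v 0 i + (i == j)%:R * (dot V V)^-1
       - 2 * (v 0 i * v 0 j))) *: vmul (edir R i) (hatc a))
  + ((n%:R - 2) / h) *: Qp (rho *: (vmul u a - vmul v (hatc a))) = 0.
Proof.
move=> XV S0 T0 h0.
have uu : dot u u = (dot X X)^-1.
  by rewrite /u dotZl dotC dotZl mulVf// mulr1.
have vv : dot v v = (dot V V)^-1.
  by rewrite /v dotZl dotC dotZl mulVf// mulr1.
under eq_bigr => j _.
  rewrite vmulBr.
  under [X in vmul _ X]eq_bigr do rewrite -scalerA.
  under [X in _ - vmul _ X]eq_bigr do rewrite -scalerA.
  rewrite -!scaler_sumr !vmulZr.
  over.
rewrite sumrB -!scaler_sumr !dirac_kernel//.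
have QZ k b : Qp (k *: b) = k *: Qp b.
  by rewrite !(QpE l)// (hatcZ l)// -scalerBr vmulZr !scalerA mulrC.
have QE : Qp (vmul u a - vmul v (hatc a)) = h *: vmul v (vmul u a)
    - h *: vmul u (vmul v (hatc a)) - vmul e (vmul u a - vmul v (hatc a)).
  by rewrite -Qp_inversion_diff// -/u -/v addrAC subrr add0r.
(* With u and v opaque, only their squared norms matter, and a rational identity in each coefficient
   is left. *)
rewrite QZ QE /W; move: uu vv {QE W}; clearbody u v => uu vv; rewrite !vmulZl !vmulBl !vmulZl !vmul_sq uu vv vmulBr.
by apply/ffunP => C; rewrite !(clDE, clNE, clZE) [RHS]ffunE; field; apply/and3P; split.
Qed.

End DiracIdentity.

(** * Iterated integrals *)

Section IteratedIntegral.
Context {R : realType}.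
Implicit Types (c : nat -> R) (f g h p q : (nat -> R) -> R) (r B M : R).

Local Notation mu := (@lebesgue_measure R).

Definition subst_coord c k t : nat -> R := fun m => if m == k then t else c m.

Lemma Rintegral_indic_sym r : 0 < r ->
  (\int[mu]_(t in [set: R]) \1_(`[- r, r]%classic) t = 2 * r)%R.
Proof.
move=> r0; rewrite /Rintegral integral_indic// setIT.
transitivity (fine (lebesgue_measure ([set` `[- r, r]] : set R))) => //.
by rewrite lebesgue_measure_itv /= lte_fin gtrN// /= opprK mulr2n mulrDl mul1r.
Qed.

Lemma integrable_cst_box r B :
  mu.-integrable setT (EFin \o (fun t => B * \1_(`[- r, r]%classic) t)).
Proof.
have := @integrableZl _ _ _ mu _ measurableT B _
  (integrable_indic_itv (- r) r true false).
by apply: eq_integrable => // t _; rewrite /= EFinM.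
Qed.

Lemma integrable_box r B (u : R -> R) : measurable_fun setT u ->
  (forall t, `|u t| <= B * \1_(`[- r, r]%classic) t) ->
  mu.-integrable setT (EFin \o u).
Proof.
move=> mu_ uB; apply: le_integrable (integrable_cst_box r B) => //.
  exact/measurable_EFinP.
by move=> t _; rewrite /= lee_fin (le_trans (uB t))// ler_norm.
Qed.

Lemma Rintegral_box_le r B (u : R -> R) : 0 < r -> measurable_fun setT u ->
  (forall t, `|u t| <= B * \1_(`[- r, r]%classic) t) ->
  `|(\int[mu]_(t in [set: R]) u t)%R| <= B * (2 * r).
Proof.
move=> r0 mu_ uB; have iu := integrable_box r B u mu_ uB.
apply: (le_trans (le_normr_Rintegral _ iu)) => //.
rewrite -(Rintegral_indic_sym r r0) -RintegralZl//; last first.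
  exact: (integrable_indic_itv (- r) r true false).
apply: le_Rintegral => //; first exact: integrable_abse iu.
exact: integrable_cst_box.
Qed.

(** * Lower semicontinuous integrands under partial integration *)

Section Dimension.
Variable N : nat.

(** Points are sequences, but closeness is required only in the first [N] coordinates; such a [g]
    therefore depends on those coordinates alone. *)
Definition lsc g := forall c a, a < g c -> exists2 d : R, 0 < d &
  forall c', (forall i, (i < N)%N -> `|c' i - c i| < d) -> a < g c'.

(** Here [k] counts the coordinates still to be integrated; each partial integral lowers it by
    one. *)
Definition supported r k g :=
  forall c, (exists2 i, (i < k)%N & r < `|c i|) -> g c = 0.

Definition box_lsc r k B g :=
  [/\ lsc g, forall c, 0 <= g c <= B & supported r k g].

(* Bounded functions supported in a box that are differences of two nonnegative
   lower semicontinuous functions: a class of integrands stable under partial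
   integration (Fatou), so that no product measure is needed. *)
Definition box_good r k g := exists B p q,
  [/\ box_lsc r k B p, box_lsc r k B q & forall c, g c = p c - q c].

Lemma lsc_section_measurable g c k : lsc g ->
  measurable_fun setT (fun t => g (subst_coord c k t)).
Proof.
move=> lg; apply/measurable_EFinP.
apply: lower_semicontinuous_measurable => t a /=.
rewrite lte_fin => /lg[d d0 dP]; exists (ball t d); first exact: nbhsx_ballx.
move=> s; rewrite /= /ball /= => ts; rewrite lte_fin; apply: dP => i _.
by rewrite /subst_coord; case: eqP => _; rewrite ?subrr ?normr0// distrC.
Qed.

Lemma box_lsc_section r k B g c t : box_lsc r k.+1 B g ->
  `|g (subst_coord c k t)| <= B * \1_(`[- r, r]%classic) t.
Proof.
move=> [_ gB gs]; have /andP[g0 gle] := gB (subst_coord c k t).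
rewrite indicE; have [/set_mem/= tr|tr] := boolP (t \in _).
  by rewrite mulr1 ger0_norm.
rewrite mulr0 (gs (subst_coord c k t)) ?normr0//; exists k => //.
rewrite /subst_coord eqxx ltNge; apply: contra tr => tr; apply/mem_set => /=.
by rewrite in_itv /= -ler_norml.
Qed.

Lemma limn_einf_ge (u : (\bar R)^nat) (x : R) :
  (forall y : R, y < x -> \forall m \near \oo, (y%:E <= u m)%E) ->
  (x%:E <= limn_einf u)%E.
Proof.
move=> H; apply/lee_addgt0Pr => e e0.
have [m _ mP] := H (x - e) (ltac:(by rewrite ltrBlDr ltrDl)).
rewrite -leeBlDr// -EFinB limn_einf_lim (cvg_lim _ (@cvg_einfs_sup _ u))//.
apply: le_trans (ereal_sup_ubound (imageP (einfs u) (I : [set: nat] m))).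
by apply: le_ereal_inf_tmp => _ [j /= mj <-]; exact: mP.
Qed.

Lemma limn_einf_le (u : (\bar R)^nat) (x : \bar R) :
  (forall m, (u m <= x)%E) -> (limn_einf u <= x)%E.
Proof.
move=> H; rewrite limn_einf_lim; apply: lime_le; first exact: is_cvg_einfs.
by apply: nearW => m; apply: le_trans (H m); apply: ereal_inf_lbound; exists m => /=.
Qed.

(** Fatou's lemma: if semicontinuity failed at [c] for the level [a], some sequence tending to [c]
    would have integrals at most [a], and then so would [c]. The bound grows by the length 2r of the
    interval. *)
Lemma box_lsc_int r k B g : 0 < r -> (k < N)%N -> box_lsc r k.+1 B g ->
  box_lsc r k (B * (2 * r))
    (fun c => \int[mu]_(t in [set: R]) g (subst_coord c k t))%R.
Proof.
move=> r0 kN bg; have [lg gB gs] := bg.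
have g0 c : 0 <= g c by have /andP[] := gB c.
have ig c : mu.-integrable setT (EFin \o (fun t => g (subst_coord c k t))).
  apply: (integrable_box r B); first exact: lsc_section_measurable.
  by move=> t; exact: box_lsc_section.
split.
- move=> c a alt; apply: contrapT => /forall2NP H.
  have /choice[cs csP] m : exists c', (forall i, (i < N)%N ->
      `|c' i - c i| < m.+1%:R^-1) /\
      (\int[mu]_(t in [set: R]) g (subst_coord c' k t) <= a)%R.
    have [|/existsNP[c' /not_implyP[cc' /negP]]] := H m.+1%:R^-1.
      by case; rewrite invr_gt0.
    by rewrite -leNgt => ?; exists c'.
  move: alt; apply/negP; rewrite -leNgt -lee_fin.
  rewrite /Rintegral fineK; last exact: (integrable_fin_num measurableT (ig c)).
  pose F m t := (g (subst_coord (cs m) k t))%:E.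
  have mF m : measurable_fun setT (F m).
    by apply/measurable_EFinP; exact: lsc_section_measurable.
  have := fatou mu measurableT mF (fun m t _ => g0 _ : (0 <= F m t)%E).
  have Fa : (limn_einf (fun m => \int[mu]_(t in setT) F m t) <= a%:E)%E.
    apply: limn_einf_le => m; have [_] := csP m.
    by rewrite -lee_fin /Rintegral fineK//; exact: (integrable_fin_num measurableT (ig (cs m))).
  move=> /le_trans/(_ Fa); apply: le_trans.
  apply: ge0_le_integral => //.
  + by move=> t _; rewrite lee_fin.
  + by apply/measurable_EFinP; exact: lsc_section_measurable.
  (* [limn_einf] is minus the [limn_esup] of the negated sequence, which gives its measurability. *)
  + have mE : measurable_fun setT (fun t => limn_esup (fun m => (- F m t)%E)).
      apply: (@measurable_fun_limn_esup _ _ _ setT (fun m t => (- F m t)%E)) => m.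
      exact: (measurableT_comp (@oppe_measurable R setT) (mF m)).
    exact: (measurableT_comp (@oppe_measurable R setT) mE).
  (* By semicontinuity of [g], every level below its value at the limit point is eventually exceeded
     along the sequence. *)
  move=> t _; apply: limn_einf_ge => y /lg[d d0 dP].
  near=> m; rewrite /F lee_fin ltW//; apply: dP => i iN.
  rewrite /subst_coord; case: eqP => _; first by rewrite subrr normr0.
  apply: (lt_trans ((csP m).1 i iN)); near: m.
  exact: near_infty_natSinv_lt (PosNum d0).
- move=> c; rewrite Rintegral_ge0//= (le_trans (ler_norm _))//.
  apply: Rintegral_box_le => //; first exact: lsc_section_measurable.
  by move=> t; exact: box_lsc_section.
- move=> c [i ik ri]; under eq_Rintegral => t _.
    rewrite gs; last first.
      by exists i; [exact: ltnW|rewrite /subst_coord (ltn_eqF ik)].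
    over.
  by rewrite Rintegral_cst// mul0r.
Unshelve. all: by end_near. Qed.

Lemma box_good_section r k g c : box_good r k.+1 g ->
  mu.-integrable setT (EFin \o (fun t => g (subst_coord c k t))) /\
  measurable_fun setT (fun t => g (subst_coord c k t)).
Proof.
move=> [B [p [q [bp bq gpq]]]].
have mS h : box_lsc r k.+1 B h -> measurable_fun setT (fun t => h (subst_coord c k t)).
  by case=> lh _ _; exact: lsc_section_measurable.
have iS h : box_lsc r k.+1 B h ->
    mu.-integrable setT (EFin \o (fun t => h (subst_coord c k t))).
  move=> bh; apply: (integrable_box r B); first exact: mS.
  by move=> t; exact: box_lsc_section.
have -> : (fun t => g (subst_coord c k t)) =
    (fun t => p (subst_coord c k t)) \- (fun t => q (subst_coord c k t)).
  by apply/funext => t; rewrite gpq.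
split; last exact: measurable_funB (mS _ bp) (mS _ bq).
exact: (integrableB measurableT (iS _ bp) (iS _ bq)).
Qed.

Lemma box_good_int r k g : 0 < r -> (k < N)%N -> box_good r k.+1 g ->
  box_good r k (fun c => \int[mu]_(t in [set: R]) g (subst_coord c k t))%R.
Proof.
move=> r0 kN [B [p [q [bp bq gpq]]]].
exists (B * (2 * r)), (fun c => \int[mu]_(t in [set: R]) p (subst_coord c k t))%R,
  (fun c => \int[mu]_(t in [set: R]) q (subst_coord c k t))%R.
split; [exact: box_lsc_int|exact: box_lsc_int|move=> c].
have iS h : box_lsc r k.+1 B h ->
    mu.-integrable setT (EFin \o (fun t => h (subst_coord c k t))).
  move=> bh; have [lh _ _] := bh.
  apply: (integrable_box r B); first exact: lsc_section_measurable.
  by move=> t; exact: box_lsc_section.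
rewrite -RintegralB; [|by []|exact: iS|exact: iS].
by apply: eq_Rintegral => t _; rewrite gpq.
Qed.

Lemma iint_linear r k a g h : 0 < r -> (k <= N)%N ->
  box_good r k g -> box_good r k h ->
  iint k (fun c => a * g c + h c) = a * iint k g + iint k h.
Proof.
move=> r0; elim: k g h => [//|k IH] g h kN gg gh /=.
rewrite -[RHS]IH; [|exact: ltnW|exact: box_good_int|exact: box_good_int].
congr iint; apply/funext => c.
have [ig _] := box_good_section _ _ _ c gg.
have [ih _] := box_good_section _ _ _ c gh.
rewrite RintegralD//; last exact: (integrableZl measurableT a ig).
by rewrite RintegralZl.
Qed.

Lemma iint_bound r k M g : 0 < r -> (k <= N)%N -> box_good r k g ->
  (forall c, `|g c| <= M) -> `|iint k g| <= M * (2 * r) ^+ k.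
Proof.
move=> r0; elim: k M g => [|k IH] M g kN gg gM /=; first by rewrite mulr1.
rewrite exprS mulrA; apply: IH; [exact: ltnW|exact: box_good_int|move=> c].
apply: Rintegral_box_le => //; first by have [] := box_good_section _ _ _ c gg.
move=> t; rewrite indicE; have [_|tr] := boolP (t \in _); first by rewrite mulr1.
(* Outside [-r, r] the constant bound has to become 0, which the supports of [p] and [q] provide. *)
have [B [p [q [[_ _ sp] [_ _ sq] ->]]]] := gg.
have out : exists2 i, (i < k.+1)%N & r < `|subst_coord c k t i|.
  exists k => //; rewrite /subst_coord eqxx ltNge; apply: contra tr => tr.
  by apply/mem_set; rewrite /= in_itv /= -ler_norml.
by rewrite sp// sq// subrr normr0 mulr0.
Qed.

End Dimension.
End IteratedIntegral.

(** * Integration of bounded continuous functions over a bounded open set *)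

Section BoundedContinuous.
Context {R : realType} {n : nat}.
Variable K : set (pointn R n).
Hypotheses (openK : open K) (bndK : bounded_set K).
Implicit Types (f g : pointn R n -> R) (x y v : pointn R n).

Lemma coord_le_norm x i : `|x 0 i| <= `|x|.
Proof.
by rewrite [leRHS]mx_normrE (le_bigmax _ (fun ij => `|x ij.1 ij.2|) (0, i)).
Qed.

Definition bounded_continuous f :=
  (exists M : R, forall x, K x -> `|f x| <= M) /\
  (forall x, K x -> {for x, continuous f}).

Definition int_on f : R := iint n (fun c => \1_K (pt n c) * f (pt n c)).

Lemma bounded_setE : exists2 r : R, 0 < r & forall x, K x -> `|x| <= r.
Proof.
case: bndK => M [_ MP]; exists (`|M| + 1); first by rewrite ltr_wpDl.
move=> x Kx; apply: (MP (`|M| + 1)) => //=.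
by rewrite (le_lt_trans (ler_norm _))// ltrDl.
Qed.

(** At a point of the open set [K] a whole neighbourhood stays in [K] and continuity applies; at any
    other point the value 0 is the minimum. *)
Lemma bounded_continuous_lsc f M r : (forall x, K x -> `|x| <= r) ->
  (forall x, K x -> 0 <= f x <= M) -> 0 <= M ->
  (forall x, K x -> {for x, continuous f}) ->
  box_lsc n r n M (fun c => \1_K (pt n c) * f (pt n c)).
Proof.
move=> Kr fM M0 cf; have nz c : 0 <= \1_K (pt n c) * f (pt n c) <= M.
  rewrite indicE; case: (boolP (_ \in K)) => [/set_mem/fM|]; rewrite ?mul1r//.
  by rewrite mul0r lexx.
split => //.
- move=> c a; rewrite {1}indicE.
  case: (boolP (_ \in K)) => [/set_mem Kc|_]; rewrite ?mul1r ?mul0r => alt.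
    have : \forall z \near pt n c, K z /\ a < f z.
      near=> z; split; near: z; first exact: open_nbhs_nbhs.
      exact: (cvgr_gt (f (pt n c)) (cf _ Kc) a alt).
    move=> /nbhs_ballP[d /= d0 dP]; exists d => // c' cc'.
    have [Kc' ac'] : K (pt n c') /\ a < f (pt n c').
      apply: dP; split => // i j; rewrite ord1 !mxE /ball /= distrC.
      exact/cc'/ltn_ord.
    by rewrite indicE mem_set// mul1r.
  exists 1 => // c' _; apply: lt_le_trans alt _.
  by have /andP[] := nz c'.
- move=> c [i iN ri]; rewrite indicE memNset ?mul0r// => /Kr.
  apply/negP; rewrite -ltNge; apply: lt_le_trans ri _.
  by have := coord_le_norm (pt n c) (Ordinal iN); rewrite mxE.
Unshelve. all: by end_near. Qed.

(** A shift by the constant |M| makes [f] nonnegative on [K], so 1_K f = 1_K (f + |M|) - 1_K |M| has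
    the required form, with common bound 2|M|. *)
Lemma bounded_continuous_good f r : (forall x, K x -> `|x| <= r) ->
  bounded_continuous f ->
  box_good n r n (fun c => \1_K (pt n c) * f (pt n c)).
Proof.
move=> Kr [[M fM] cf].
have fM' x : K x -> `|f x| <= `|M| by move=> /fM /le_trans -> //; exact: ler_norm.
exists (`|M| + `|M|), (fun c => \1_K (pt n c) * (f (pt n c) + `|M|)),
  (fun c => \1_K (pt n c) * `|M|); split.
- apply: (bounded_continuous_lsc (fun x => f x + `|M|)) => //.
  + move=> x /fM'; rewrite ler_norml => /andP[lo hi].
    by rewrite lerD2r hi andbT -lerBlDr sub0r.
  + by move=> x Kx; exact: (cvgD (cf x Kx) (cvg_cst _)).
- apply: (bounded_continuous_lsc (fun x => `|M|)) => //.
  + by move=> x _; rewrite normr_ge0 lerDl normr_ge0.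
  + by move=> x _; exact: cst_continuous.
- by move=> c; rewrite -mulrBr addrK.
Qed.

Lemma int_on_linear a f g : bounded_continuous f -> bounded_continuous g ->
  int_on (fun x => a * f x + g x) = a * int_on f + int_on g.
Proof.
have [r r0 Kr] := bounded_setE; move=> af ag.
rewrite /int_on -(iint_linear n r n a)//; try exact: bounded_continuous_good.
by congr iint; apply/funext => c; ring.
Qed.

(** The constant is the volume (2r)^n of a cube containing [K]. It is independent of [f], so the
    integral is continuous for uniform convergence on [K]. *)
Lemma int_on_bound : exists2 B : R, 0 < B & forall f M, bounded_continuous f ->
  (forall x, K x -> `|f x| <= M) -> 0 <= M -> `|int_on f| <= M * B.
Proof.
have [r r0 Kr] := bounded_setE; exists ((2 * r) ^+ n).
  by rewrite exprn_gt0// mulr_gt0.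
move=> f M af fM M0; apply: (iint_bound n r n M) => //.
  exact: (bounded_continuous_good f r Kr af).
move=> c; rewrite indicE; case: (boolP (_ \in K)) => [/set_mem/fM|_].
  by rewrite mul1r.
by rewrite mul0r normr0.
Qed.

Lemma bounded_continuous_cst k : bounded_continuous (fun=> k).
Proof. by split; [by exists (`|k|) | move=> x _; exact: cst_continuous]. Qed.

Lemma bounded_continuousD f g : bounded_continuous f -> bounded_continuous g ->
  bounded_continuous (fun x => f x + g x).
Proof.
move=> [[M fM] cf] [[M' gM] cg]; split.
  by exists (M + M') => x Kx; rewrite (le_trans (ler_normD _ _))// lerD ?fM ?gM.
by move=> x Kx; exact: (cvgD (cf x Kx) (cg x Kx)).
Qed.

Lemma bounded_continuousM f g : bounded_continuous f -> bounded_continuous g ->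
  bounded_continuous (fun x => f x * g x).
Proof.
move=> [[M fM] cf] [[M' gM] cg]; split.
  exists (M * M') => x Kx; rewrite normrM ler_pM ?fM ?gM//.
by move=> x Kx; exact: (cvgM (cf x Kx) (cg x Kx)).
Qed.

Lemma bounded_continuous_sum (I : finType) (f : I -> pointn R n -> R) :
  (forall i, bounded_continuous (f i)) ->
  bounded_continuous (fun x => \sum_i f i x).
Proof.
move=> H; rewrite (_ : (fun x => _) = \sum_i f i); last first.
  by apply/funext => x; rewrite fct_sumE.
elim/big_ind: _ => //; first exact: (bounded_continuous_cst 0).
by move=> u w; exact: bounded_continuousD.
Qed.

Lemma int_on0 : int_on (fun=> 0) = 0.
Proof.
have a0 := bounded_continuous_cst 0.
rewrite -[RHS](addNr (int_on (fun=> 0))) -mulN1r -int_on_linear//.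
by congr int_on; apply/funext => x; rewrite mulr0 addr0.
Qed.

Lemma int_onD f g : bounded_continuous f -> bounded_continuous g ->
  int_on (fun x => f x + g x) = int_on f + int_on g.
Proof.
move=> af ag; rewrite -[int_on f]mul1r -int_on_linear//.
by congr int_on; apply/funext => x; rewrite mul1r.
Qed.

Lemma int_onZ k f : bounded_continuous f ->
  int_on (fun x => k * f x) = k * int_on f.
Proof.
move=> af; rewrite -[RHS]addr0 -[X in _ = _ + X]int_on0 -int_on_linear//.
  by congr int_on; apply/funext => x; rewrite addr0.
exact: bounded_continuous_cst.
Qed.

Lemma int_onB f g : bounded_continuous f -> bounded_continuous g ->
  int_on (fun x => f x - g x) = int_on f - int_on g.
Proof.
move=> af ag; rewrite addrC -mulN1r -int_on_linear//.
by congr int_on; apply/funext => x; rewrite mulN1r addrC.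
Qed.

Lemma int_on_sum (I : finType) (f : I -> pointn R n -> R) :
  (forall i, bounded_continuous (f i)) ->
  int_on (fun x => \sum_i f i x) = \sum_i int_on (f i).
Proof.
move=> H.
(* Both claims go through the induction together, since additivity requires the partial sum to be
   bounded and continuous. *)
suff [_] : bounded_continuous (\sum_i f i) /\
    int_on (\sum_i f i) = \sum_i int_on (f i).
  by move=> <-; congr int_on; apply/funext => x; rewrite fct_sumE.
elim/big_rec2: _ => [|i y h _ [ah eh]].
  by split; [exact: (bounded_continuous_cst 0)|exact: int_on0].
split; first exact: bounded_continuousD.
by rewrite -eh -int_onD.
Qed.

End BoundedContinuous.

(** * Differentiation under the integral sign *)

Section LineDerivative.
Context {R : realType} {V : normedModType R}.
Implicit Types (f : V -> R) (y v : V).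

(** Both difference quotients are the same function of h. This carries the one-variable mean value
    theorem and chain rule over to directional derivatives. *)
Lemma is_derive_line f y v (s d : R) :
  is_derive (s *: v + y) v f d <-> is_derive s 1 (fun t => f (t *: v + y)) d.
Proof.
have E : (fun h : R => h^-1 *: ((f \o shift (s *: v + y)) (h *: v) - f (s *: v + y)))
   = (fun h : R => h^-1 *: (((fun t : R => f (t *: v + y)) \o shift s) (h *: 1)
        - f (s *: v + y))).
  by apply/funext => h /=; rewrite [h *: 1]mulr1 scalerDl addrA.
split=> -[a b]; split.
- by move: a; rewrite /derivable E.
- by move: b; rewrite /derive E.
- by rewrite /derivable E.
- by rewrite /derive E.
Qed.

(** The mean value theorem writes the error as h (dphi c - D) with |c| < d. The radius d depends on
    [phi] only through the two hypotheses, so the estimate is uniform over a family of functions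
    sharing them. *)
Lemma mean_value_approx (phi dphi : R -> R) (D e d : R) :
  (forall s : R, `|s| < d -> is_derive s 1 phi (dphi s)) ->
  (forall s : R, `|s| < d -> `|dphi s - D| <= e) ->
  forall h : R, `|h| < d -> `|phi h - phi 0 - h * D| <= `|h| * e.
Proof.
move=> Hd He h hd.
have mvt (a b : R) : a <= b -> `|a| < d -> `|b| < d ->
    exists2 c : R, `|c| < d & phi b - phi a = dphi c * (b - a).
  move=> ab ad bd.
  have cd c : c \in `[a, b] -> `|c| < d.
    rewrite in_itv /= => /andP[ac cb]; move: ad bd; rewrite !ltr_norml.
    by move=> /andP[a1 _] /andP[_ b2]; rewrite (lt_le_trans a1)// (le_lt_trans cb).
  have [c cab ->] : exists2 c, c \in `[a, b] & phi b - phi a = dphi c * (b - a).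
    apply: MVT_segment => // [x xab|].
      by apply/Hd/cd; exact: subset_itv_oo_cc.
    by apply: derivable_within_continuous => x /cd/Hd[].
  by exists c => //; exact: cd.
have d0 : `|0 : R| < d by rewrite normr0 (le_lt_trans _ hd).
have [h0|h0] := leP 0 h.
  have [c cd ->] := mvt _ _ h0 d0 hd.
  by rewrite subr0 mulrC -mulrBr normrM ler_wpM2l// He.
have [c cd E] := mvt _ _ (ltW h0) hd d0.
have -> : phi h - phi 0 - h * D = h * (dphi c - D).
  by rewrite -(opprB (phi 0)) E; ring.
by rewrite normrM ler_wpM2l// He.
Qed.

End LineDerivative.

(** * Parameter integrals with jointly continuous kernels *)

Section DerivativeUnderIntegral.
Context {R : realType} {n : nat}.
Variables (K U : set (pointn R n)).
Hypotheses (openK : open K) (bndK : bounded_set K) (openU : open U).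
Implicit Types (k dk : pointn R n -> pointn R n -> R) (f : pointn R n -> R).
Implicit Types (x y v : pointn R n).

Definition jointly_continuous k := forall x y, closure K x -> U y ->
  {for (x, y), continuous (fun z : pointn R n * pointn R n => k z.1 z.2)}.

Lemma compact_closure : compact (closure K).
Proof.
apply: bounded_closed_compact; last exact: closed_closure.
have [r r0 Kr] := bounded_setE K bndK.
have cl : closure K `<=` [set x | `|x| <= r].
  have /closure_id -> : closed [set x : pointn R n | `|x| <= r].
    apply: (@preimage_closed _ _ (fun x : pointn R n => `|x|) [set t | t <= r]).
      by move=> x _; exact: norm_continuous.
    exact: closed_le.
  exact: closure_subset.
exists r; split=> [|M rM x /cl /= xr]; first exact: num_real.
exact: le_trans xr (ltW rM).
Qed.

(** Tube lemma: joint continuity gives a product neighbourhood around each (x, y), and compactness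
    of the closure of [K] yields one neighbourhood of [y] that serves all x. *)
Lemma kernel_uniform k y (e : R) : jointly_continuous k -> U y -> 0 < e ->
  \forall z \near y, forall x, closure K x -> `|k x z - k x y| <= e.
Proof.
move=> ck Uy e0.
have /compact_near_coveringP/(_ _ (nbhs y) (fun z x => `|k x z - k x y| <= e)) :=
  compact_closure; apply => x Kx.
have e20 : 0 < e / 2 by rewrite divr_gt0.
have /cvgrPdist_le/(_ _ e20) := ck x y Kx Uy.
move=> [[A B] [/= nA nB] AB].
exists (A, B) => //= -[x' z] /= [Ax' Bz].
have := AB (x', z) (conj Ax' Bz); have := AB (x', y) (conj Ax' (nbhs_singleton nB)).
rewrite /= => h1 h2.
rewrite [e]splitr (_ : _ - _ = (k x y - k x' y) - (k x y - k x' z)); last by ring.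
by rewrite (le_trans (ler_normB _ _))// lerD.
Qed.

Lemma kernel_bounded_continuous k y : jointly_continuous k -> U y ->
  bounded_continuous K (k^~ y).
Proof.
move=> ck Uy.
have ck' x : closure K x -> {for x, continuous (k^~ y)}.
  move=> Kx; apply: (continuous_comp (f := fun x => (x, y))
    (g := fun z : pointn R n * pointn R n => k z.1 z.2)); last exact: ck.
  apply: (@cvg_pair _ _ _ (nbhs x) (nbhs x) (nbhs y) _ _ _ id (fun=> y)).
    exact: cvg_id.
  exact: cst_continuous.
split; last by move=> x Kx; exact/ck'/subset_closure.
have : compact [set k x y | x in closure K].
  apply: continuous_compact; last exact: compact_closure.
  by apply: continuous_in_subspaceT => x /set_mem; exact: ck'.
move=> /compact_bounded[M [_ MP]]; exists (M + 1) => x Kx.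
apply: (MP (M + 1)); first by rewrite ltrDl.
by exists x => //; exact: subset_closure.
Qed.

Lemma int_on_continuous k f y : jointly_continuous k -> bounded_continuous K f ->
  U y -> {for y, continuous (fun y => int_on K (fun x => k x y * f x))}.
Proof.
move=> ck af Uy; have [B B0 HB] := int_on_bound K openK bndK.
have [[M fM] _] := af.
have M0 : 0 < `|M| + 1 by rewrite ltr_wpDl.
apply/(@cvgrPdist_le _ _ _ (nbhs y)) => e e0.
(* The tolerance is divided by the bound on [f] and by the norm [B] of the integral; the added 1
   keeps the divisor positive. *)
have e1 : 0 < e / ((`|M| + 1) * B) by rewrite divr_gt0// mulr_gt0.
have nU : \forall z \near y, U z by exact: open_nbhs_nbhs.
near=> z.
have Uz : U z by near: z.
have zE : forall x, closure K x -> `|k x z - k x y| <= e / ((`|M| + 1) * B).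
  by near: z; exact: kernel_uniform.
rewrite -int_onB//; try (by apply: bounded_continuousM => //;
  exact: kernel_bounded_continuous).
have -> : e = e / ((`|M| + 1) * B) * (`|M| + 1) * B.
  by field; rewrite !gt_eqF.
apply: HB.
- have E : (fun x => k x y * f x - k x z * f x) = (fun x => (k x y + -1 * k x z) * f x).
    by apply/funext => x; ring.
  rewrite E; apply: bounded_continuousM => //; apply: bounded_continuousD.
    exact: kernel_bounded_continuous.
  apply: bounded_continuousM; first exact: bounded_continuous_cst.
  exact: kernel_bounded_continuous.
- move=> x Kx; rewrite -mulrBl normrM; apply: ler_pM => //.
    by rewrite distrC zE//; exact: subset_closure.
  by rewrite (le_trans (fM x Kx))// (le_trans (ler_norm _))// lerDl.
- by rewrite mulr_ge0// ltW.
Unshelve. all: by end_near. Qed.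

(** By linearity the error of the difference quotient is one integral, whose integrand is the
    first-order remainder of [k x] divided by h, times [f x]. Uniform closeness of [dk] along the
    line and the mean value estimate bound the remainder quotient by [e'] for all x at once. *)
Lemma int_on_derive k dk f y v : jointly_continuous k -> jointly_continuous dk ->
  (forall x z, closure K x -> U z -> is_derive z v (k x) (dk x z)) ->
  bounded_continuous K f -> U y ->
  is_derive y v (fun y => int_on K (fun x => k x y * f x))
    (int_on K (fun x => dk x y * f x)).
Proof.
move=> ck cdk Dk af Uy; have [B B0 HB] := int_on_bound K openK bndK.
have [[M fM] _] := af.
have M0 : 0 < `|M| + 1 by rewrite ltr_wpDl.
suff cv : (h^-1 *: (((fun y => int_on K (fun x => k x y * f x)) \o shift y) (h *: v)
    - int_on K (fun x => k x y * f x))) @[h --> (0:R)^'] -->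
    int_on K (fun x => dk x y * f x).
  by split; [apply/cvg_ex; eexists; exact: cv|exact: cvg_lim cv].
apply/cvgrPdist_le => e e0.
set e' := e / ((`|M| + 1) * B).
have e'0 : 0 < e' by rewrite divr_gt0// mulr_gt0.
have nU : \forall z \near y, U z by exact: open_nbhs_nbhs.
have line : (h *: v + y) @[h --> (0:R)] --> y.
  rewrite -[X in _ --> X](add0r y) -[X in _ --> X + y](scale0r v).
  exact: (cvgD (cvgZr_tmp cvg_id) (cvg_cst y)).
have near0 : \forall h \near (0:R), U (h *: v + y) /\
    forall x, closure K x -> `|dk x (h *: v + y) - dk x y| <= e'.
  exact: filterI (line _ nU) (line _ (kernel_uniform dk y e' cdk Uy e'0)).
move/nbhs_ballP : near0 => [d /= d0 dP].
have dP' (h : R) : `|h| < d -> U (h *: v + y) /\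
    forall x, closure K x -> `|dk x (h *: v + y) - dk x y| <= e'.
  by move=> hd; apply: dP; rewrite /ball /= sub0r normrN.
have nd : \forall h \near (0:R)^', `|h| < d.
  apply: nbhs_dnbhs; apply/nbhs_ballP; exists d => // h; rewrite /ball /= sub0r.
  by rewrite normrN.
near=> h.
have h0 : h != 0 by near: h; exact: nbhs_dnbhs_neq.
have hd : `|h| < d by near: h.
have [Uh _] := dP' h hd.
have akf z : U z -> bounded_continuous K (fun x => k x z * f x).
  by move=> Uz; apply: bounded_continuousM => //; exact: kernel_bounded_continuous.
have adkf : bounded_continuous K (fun x => dk x y * f x).
  by apply: bounded_continuousM => //; exact: kernel_bounded_continuous.
rewrite /= -int_onB//; try exact: akf.
have ad : bounded_continuous K (fun x => k x (h *: v + y) * f x - k x y * f x).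
  have -> : (fun x => k x (h *: v + y) * f x - k x y * f x) =
      (fun x => k x (h *: v + y) * f x + -1 * (k x y * f x)).
    by apply/funext => x; ring.
  apply: bounded_continuousD; first exact: akf.
  by apply: bounded_continuousM; [exact: bounded_continuous_cst|exact: akf].
(* Limit minus quotient is brought to the shape a * f + g with a = -1/h. *)
rewrite addrC -scaleNr -int_on_linear//.
have -> : e = e' * (`|M| + 1) * B.
  by rewrite /e'; field; rewrite !gt_eqF.
apply: HB.
- apply: bounded_continuousD => //; apply: bounded_continuousM => //.
  exact: bounded_continuous_cst.
- move=> x Kx.
  have cKx := subset_closure Kx.
  have -> : - h^-1 * (k x (h *: v + y) * f x - k x y * f x) + dk x y * f x =
      - h^-1 * (k x (h *: v + y) - k x y - h * dk x y) * f x.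
    by field.
  rewrite normrM; apply: ler_pM => //; last first.
    by rewrite (le_trans (fM x Kx))// (le_trans (ler_norm _))// lerDl.
  rewrite normrM normrN normfV ler_pdivrMl ?normr_gt0//.
  have Ds (s : R) : `|s| < d ->
      is_derive s 1 (fun t => k x (t *: v + y)) (dk x (s *: v + y)).
    move=> sd; have [Us _] := dP' s sd.
    exact: (proj1 (is_derive_line (k x) y v s _) (Dk x _ cKx Us)).
  have De (s : R) : `|s| < d -> `|dk x (s *: v + y) - dk x y| <= e'.
    by move=> sd; have [_] := dP' s sd; apply.
  have := mean_value_approx (fun t => k x (t *: v + y)) (fun t => dk x (t *: v + y))
    (dk x y) e' d Ds De h hd.
  by rewrite scale0r add0r.
- by rewrite mulr_ge0// ltW.
Unshelve. all: by end_near. Qed.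

End DerivativeUnderIntegral.

(** * Regularity of the kernels *)

Section DerivativeRules.
Context {R : realType} {V : normedModType R}.
Implicit Types (f g : V -> R) (y v : V).

Lemma is_derive_mul f g y v (a b : R) : is_derive y v f a -> is_derive y v g b ->
  is_derive y v (fun z => f z * g z) (f y * b + g y * a).
Proof. by move=> fa gb; exact: (is_deriveM fa gb). Qed.

Lemma is_derive_comp f y v (phi : R -> R) (a b : R) :
  is_derive (f y) 1 phi a -> is_derive y v f b ->
  is_derive y v (fun z => phi (f z)) (a * b).
Proof.
have E : 0 *: v + y = y by rewrite scale0r add0r.
move=> pa fb; have fb' : is_derive (0 *: v + y) v f b by rewrite E.
suff : is_derive (0 *: v + y) v (fun z => phi (f z)) (a * b) by rewrite E.
apply: (proj2 (is_derive_line _ y v 0 _)).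
apply: is_derive1_comp (proj1 (is_derive_line f y v 0 b) fb').
by rewrite E.
Qed.

Lemma is_derive_invf f y v (a : R) : f y != 0 -> is_derive y v f a ->
  is_derive y v (fun z => (f z)^-1) (- (f y) ^- 2 * a).
Proof.
move=> f0 fa; apply: (is_derive_comp f y v (fun t => t^-1)) fa.
apply: is_derive_eq (is_deriveV f0 (is_derive_id (f y) 1)) _.
by rewrite /GRing.scale /= mulr1.
Qed.

(** Derivatives are kept as value times logarithmic derivative, so factors combine by addition and
    the gradient of the weight appears directly as [log_grad]. *)
Lemma is_derive_logM f g y v (a b : R) :
  is_derive y v f (f y * a) -> is_derive y v g (g y * b) ->
  is_derive y v (fun z => f z * g z) (f y * g y * (a + b)).
Proof.
by move=> fa gb; apply: is_derive_eq (is_derive_mul _ _ _ _ _ _ fa gb) _; ring.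
Qed.

Lemma is_derive_logX f y v m (a : R) : f y != 0 -> is_derive y v f a ->
  is_derive y v (fun z => f z ^+ m) (f y ^+ m * (m%:R * (a / f y))).
Proof.
move=> f0 fa; rewrite (_ : (fun z => _) = f ^+ m); last first.
  by apply/funext => z; rewrite exprfctE.
apply: is_derive_eq (is_deriveX m fa) _.
case: m => [|m]; rewrite /GRing.scale /= ?mul0r ?mulr0 ?mul0r//.
by rewrite exprS; field.
Qed.

Lemma is_derive_log_sqrtV f y v m (a : R) : 0 < f y -> is_derive y v f a ->
  is_derive y v (fun z => (Num.sqrt (f z) ^+ m)^-1)
    ((Num.sqrt (f y) ^+ m)^-1 * (- (m%:R * (a / (2 * f y))))).
Proof.
move=> f0 fa; have q0 : Num.sqrt (f y) != 0 by rewrite gt_eqF// sqrtr_gt0.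
have qa := is_derive_comp _ _ _ _ _ _ (is_derive1_sqrt f0) fa.
have qm := is_derive_logX _ _ _ m _ q0 qa.
apply: is_derive_eq (is_derive_invf _ _ _ _ _ qm) _.
  by rewrite expf_neq0.
have qm0 : Num.sqrt (f y) ^+ m != 0 by rewrite expf_neq0.
have := sqr_sqrtr (ltW f0).
move: (Num.sqrt (f y)) q0 qm0 => q q0; move: (q ^+ m) => p p0 <-.
by field; rewrite ?p0 ?q0.
Qed.

End DerivativeRules.

Section ContinuousAt.
Context {R : realType} {T : topologicalType}.
Implicit Types (f g : T -> R) (p : T).

Lemma continuous_at_ext f g p : f =1 g -> {for p, continuous f} ->
  {for p, continuous g}.
Proof. by move=> /funext ->. Qed.

Lemma continuous_atD f g p : {for p, continuous f} -> {for p, continuous g} ->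
  {for p, continuous (fun z => f z + g z)}.
Proof. by move=> cf cg; exact: (cvgD cf cg). Qed.

Lemma continuous_atB f g p : {for p, continuous f} -> {for p, continuous g} ->
  {for p, continuous (fun z => f z - g z)}.
Proof. by move=> cf cg; exact: (cvgB cf cg). Qed.

Lemma continuous_atM f g p : {for p, continuous f} -> {for p, continuous g} ->
  {for p, continuous (fun z => f z * g z)}.
Proof. by move=> cf cg; exact: (cvgM cf cg). Qed.

Lemma continuous_atV f p : f p != 0 -> {for p, continuous f} ->
  {for p, continuous (fun z => (f z)^-1)}.
Proof. by move=> f0 cf; exact: (cvgV f0 cf). Qed.

Lemma continuous_at_cst (a : R) p : {for p, continuous (fun=> a)}.
Proof. exact: cst_continuous. Qed.

Lemma continuous_at_comp f p (phi : R -> R) : continuous phi ->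
  {for p, continuous f} -> {for p, continuous (fun z => phi (f z))}.
Proof. by move=> cphi cf; exact: (continuous_comp cf (cphi (f p))). Qed.

Lemma continuous_at_sum n (f : 'I_n -> T -> R) p :
  (forall i, {for p, continuous (f i)}) ->
  {for p, continuous (fun z => \sum_i f i z)}.
Proof.
move=> cf; rewrite (_ : (fun z => _) = \sum_i f i); last first.
  by apply/funext => z; rewrite fct_sumE.
elim/big_ind: _ => [|g h cg ch|i _]; [exact: cst_continuous| |exact: cf].
exact: (cvgD cg ch).
Qed.

End ContinuousAt.

(** * The two kernels as functions of both points: derivatives and joint continuity *)

Section Kernel.
Context {R : realType} {n : nat}.
Variable l : 'I_n.
Hypothesis lE : val l = n.-1.
Implicit Types (x y z : pointn R n) (b : bool).

Local Notation e := (edir R l).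

(** The flag selects the singularity: x for the kernel E, its mirror image for F. *)
Definition pole b x := if b then hatv x else x.

Definition sqdist z y : R := dot (y - z) (y - z).

(** The Clifford inverse of z - y as a point; the minus sign in -x / |x|^2 reverses the
    difference. *)
Definition inv_vec z y : pointn R n := (sqdist z y)^-1 *: (y - z).

Definition weight x y : R := lastc y ^+ (n - 2) *
  ((Num.sqrt (sqdist x y) ^+ (n - 2))^-1 *
   (Num.sqrt (sqdist (hatv x) y) ^+ (n - 2))^-1).

Definition log_grad x y : pointn R n :=
  (n%:R - 2) *: ((lastc y)^-1 *: e - inv_vec x y - inv_vec (hatv x) y).

Definition kern b i x y : R := weight x y * inv_vec (pole b x) y 0 i.

Definition dkern b i j x y : R := weight x y *
  (log_grad x y 0 j * inv_vec (pole b x) y 0 i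
   + (i == j)%:R * (sqdist (pole b x) y)^-1
   - 2 * (inv_vec (pole b x) y 0 i * inv_vec (pole b x) y 0 j)).

Lemma lastcE y : lastc y = y 0 l.
Proof. by rewrite /lastc /coordn -lE valK. Qed.

Lemma sqdist_gt0 z y : y != z -> 0 < sqdist z y.
Proof.
rewrite -subr_eq0 => /eqP yz; rewrite lt_def sumr_ge0 ?andbT => [|i _].
  apply: contra_not_neq yz => /eqP; rewrite psumr_eq0 => [/allP H|i _].
    apply/rowP => i; rewrite [RHS]mxE.
    by have /eqP/eqP := H i (mem_index_enum i); rewrite mulf_eq0 orbb => /eqP.
  by rewrite -expr2 sqr_ge0.
by rewrite -expr2 sqr_ge0.
Qed.

(** The mirror image of a point of the upper half-space has negative last coordinate. *)
Lemma pole_neq b x y : 0 < lastc x -> 0 < lastc y -> y != x -> y != pole b x.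
Proof.
case: b => //= x0 y0 _; apply/eqP => E; move: y0.
by rewrite E !lastcE (hatvE _ _ _ lE) eqxx mulN1r -lastcE oppr_gt0 ltNge ltW.
Qed.

Lemma is_derive_coord y v i : is_derive y v (fun z : pointn R n => z 0 i) (v 0 i).
Proof.
have E : h^-1 *: (((fun z : pointn R n => z 0 i) \o shift y) (h *: v) - y 0 i)
    @[h --> (0 : R)^'] --> v 0 i.
  apply/cvgrPdist_le => d d0; near=> h.
  have h0 : h != 0 by near: h; exact: nbhs_dnbhs_neq.
  by rewrite /= !mxE addrK /GRing.scale /= mulKf// subrr normr0 ltW.
by split; [apply/cvg_ex; eexists; exact: E|exact: cvg_lim E].
Unshelve. all: by end_near. Qed.

Lemma is_derive_coordB y v z i :
  is_derive y v (fun w : pointn R n => (w - z) 0 i) (v 0 i).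
Proof.
have -> : (fun w : pointn R n => (w - z) 0 i) = (fun w => w 0 i) - cst (z 0 i).
  by apply/funext => w; rewrite !mxE.
rewrite -[v 0 i]subr0; apply: is_deriveB; first exact: is_derive_coord.
exact: is_derive_cst.
Qed.

Lemma is_derive_sqdist z y j :
  is_derive y (edir R j) (sqdist z) (2 * (y - z) 0 j).
Proof.
have -> : sqdist z = \sum_(i < n) (fun w : pointn R n => (w - z) 0 i * (w - z) 0 i).
  by apply/funext => w; rewrite fct_sumE.
apply: is_derive_eq.
  by apply: is_derive_sum => i; exact: (is_derive_mul _ _ _ _ _ _
    (is_derive_coordB y (edir R j) z i) (is_derive_coordB y (edir R j) z i)).
rewrite (bigD1 j)//= big1 => [|i ij]; rewrite edirE ?(negbTE ij) ?eqxx /=; ring.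
Qed.

Lemma is_derive_inv_vec z y i j : y != z ->
  is_derive y (edir R j) (fun w => inv_vec z w 0 i)
    ((i == j)%:R * (sqdist z y)^-1 - 2 * (inv_vec z y 0 i * inv_vec z y 0 j)).
Proof.
move=> yz; have S0 : sqdist z y != 0 by rewrite gt_eqF// sqdist_gt0.
have -> : (fun w => inv_vec z w 0 i) = (fun w => (sqdist z w)^-1 * (w - z) 0 i).
  by apply/funext => w; rewrite mxE.
apply: is_derive_eq (is_derive_mul _ _ _ _ _ _
  (is_derive_invf _ _ _ _ S0 (is_derive_sqdist z y j))
  (is_derive_coordB y (edir R j) z i)) _.
rewrite edirE [inv_vec z y 0 i]mxE [inv_vec z y 0 j]mxE.
by field.
Qed.

Lemma is_derive_weight x y j : (1 < n)%N -> 0 < lastc y -> y != x -> y != hatv x ->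
  is_derive y (edir R j) (weight x) (weight x y * log_grad x y 0 j).
Proof.
move=> n1 y0 yx yx'.
have S0 := sqdist_gt0 _ _ yx; have T0 := sqdist_gt0 _ _ yx'.
have Dl : is_derive y (edir R j) (@lastc R n) (edir R j 0 l).
  have -> : @lastc R n = (fun z => z 0 l) by apply/funext => z; rewrite lastcE.
  exact: is_derive_coord.
apply: is_derive_eq (is_derive_logM _ _ _ _ _ _
  (is_derive_logX _ _ _ (n - 2) _ (lt0r_neq0 y0) Dl)
  (is_derive_logM _ _ _ _ _ _
    (is_derive_log_sqrtV _ _ _ (n - 2) _ S0 (is_derive_sqdist x y j))
    (is_derive_log_sqrtV _ _ _ (n - 2) _ T0 (is_derive_sqdist (hatv x) y j)))) _.
(* The truncated exponent n - 2 becomes the real number n - 2, which is legitimate because 2 <=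
   n. *)
congr (_ * _); rewrite natrB// /log_grad /inv_vec !mxE eqxx (eq_sym l j).
by field; rewrite !gt_eqF.
Qed.

Lemma is_derive_kern b i j x y : (1 < n)%N -> 0 < lastc x -> 0 < lastc y -> y != x ->
  is_derive y (edir R j) (kern b i x) (dkern b i j x y).
Proof.
move=> n1 x0 y0 yx.
apply: is_derive_eq (is_derive_mul _ _ _ _ _ _
  (is_derive_weight x y j n1 y0 yx (pole_neq true _ _ x0 y0 yx))
  (is_derive_inv_vec (pole b x) y i j (pole_neq b _ _ x0 y0 yx))) _.
rewrite /dkern; ring.
Qed.

Local Notation continuous2_at k x y :=
  {for (x, y), continuous (fun z : pointn R n * pointn R n => k z.1 z.2)}.

Lemma continuous2_snd x y i : continuous2_at (fun _ w => w 0 i : R) x y.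
Proof.
apply: (continuous_comp (f := snd) (g := fun w : pointn R n => w 0 i)).
  exact: cvg_snd.
exact: coord_continuous.
Qed.

Lemma continuous2_pole b x y i : continuous2_at (fun w _ => pole b w 0 i : R) x y.
Proof.
have c1 : continuous2_at (fun w _ => w 0 i : R) x y.
  apply: (continuous_comp (f := fst) (g := fun w : pointn R n => w 0 i)).
    exact: cvg_fst.
  exact: coord_continuous.
case: b => //=; apply: (continuous_at_ext (fun z : pointn R n * pointn R n =>
  (-1) ^+ (l == i) * z.1 0 i)).
  by move=> z; rewrite (hatvE _ _ _ lE).
by apply: continuous_atM => //; exact: continuous_at_cst.
Qed.

Lemma continuous2_sub b x y i :
  continuous2_at (fun u w => (w - pole b u) 0 i : R) x y.
Proof.
apply: (continuous_at_ext (fun z : pointn R n * pointn R n => z.2 0 i - pole b z.1 0 i)).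
  by move=> z; rewrite !mxE.
by apply: continuous_atB; [exact: continuous2_snd|exact: continuous2_pole].
Qed.

Lemma continuous2_sqdist b x y : continuous2_at (fun u w => sqdist (pole b u) w) x y.
Proof.
apply: continuous_at_sum => i.
by apply: continuous_atM; exact: continuous2_sub.
Qed.

Lemma continuous2_sqdistV b x y : y != pole b x ->
  continuous2_at (fun u w => (sqdist (pole b u) w)^-1) x y.
Proof.
move=> yx; apply: continuous_atV (continuous2_sqdist b x y).
by rewrite gt_eqF// sqdist_gt0.
Qed.

Lemma continuous2_inv_vec b x y i : y != pole b x ->
  continuous2_at (fun u w => inv_vec (pole b u) w 0 i) x y.
Proof.
move=> yx; apply: (continuous_at_ext (fun z : pointn R n * pointn R n =>
  (sqdist (pole b z.1) z.2)^-1 * (z.2 - pole b z.1) 0 i)).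
  by move=> z; rewrite [RHS]mxE.
by apply: continuous_atM; [exact: continuous2_sqdistV|exact: continuous2_sub].
Qed.

Lemma continuous2_sqrtV b x y m : y != pole b x ->
  continuous2_at (fun u w => (Num.sqrt (sqdist (pole b u) w) ^+ m)^-1) x y.
Proof.
move=> yx; apply: continuous_atV.
  by rewrite expf_neq0// gt_eqF// sqrtr_gt0 sqdist_gt0.
apply: (continuous_at_comp _ _ (fun t => t ^+ m)); first exact: exprn_continuous.
apply: (continuous_at_comp _ _ Num.sqrt); first exact: sqrt_continuous.
exact: continuous2_sqdist.
Qed.

Lemma continuous2_lastc x y : continuous2_at (fun _ w => lastc w) x y.
Proof.
apply: (continuous_at_ext (fun z : pointn R n * pointn R n => z.2 0 l)); last exact: continuous2_snd.
by move=> z; rewrite lastcE.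
Qed.

Lemma continuous2_weight x y : 0 < lastc x -> 0 < lastc y -> y != x ->
  continuous2_at weight x y.
Proof.
move=> x0 y0 yx; apply: continuous_atM.
  apply: (continuous_at_comp _ _ (fun t => t ^+ (n - 2))).
    exact: exprn_continuous.
  exact: continuous2_lastc.
apply: continuous_atM; first exact: (continuous2_sqrtV false).
exact: (continuous2_sqrtV true _ _ _ (pole_neq true _ _ x0 y0 yx)).
Qed.

Lemma continuous2_log_grad x y i : 0 < lastc x -> 0 < lastc y -> y != x ->
  continuous2_at (fun u w => log_grad u w 0 i) x y.
Proof.
move=> x0 y0 yx; apply: (continuous_at_ext (fun z : pointn R n * pointn R n =>
  (n%:R - 2) * ((lastc z.2)^-1 * e 0 i - inv_vec (pole false z.1) z.2 0 i
    - inv_vec (pole true z.1) z.2 0 i))).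
  by move=> z; rewrite !mxE.
apply: continuous_atM; first exact: continuous_at_cst.
apply: continuous_atB; last exact: continuous2_inv_vec _ _ _ _ (pole_neq true _ _ x0 y0 yx).
apply: continuous_atB; last exact: (continuous2_inv_vec false).
apply: continuous_atM; last exact: continuous_at_cst.
by apply: continuous_atV (continuous2_lastc x y); rewrite gt_eqF.
Qed.

Lemma continuous2_kern b i x y : 0 < lastc x -> 0 < lastc y -> y != x ->
  continuous2_at (kern b i) x y.
Proof.
move=> x0 y0 yx; apply: continuous_atM; first exact: continuous2_weight.
exact: continuous2_inv_vec _ _ _ _ (pole_neq b _ _ x0 y0 yx).
Qed.

Lemma continuous2_dkern b i j x y : 0 < lastc x -> 0 < lastc y -> y != x ->
  continuous2_at (dkern b i j) x y.
Proof.
move=> x0 y0 yx; have yp := pole_neq b _ _ x0 y0 yx.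
have ci k := continuous2_inv_vec b x y k yp.
have cst a := continuous_at_cst (a : R) (x, y).
apply: continuous_atM; first exact: continuous2_weight.
apply: continuous_atB.
  apply: continuous_atD; last exact/continuous_atM/continuous2_sqdistV.
  by apply: continuous_atM => //; exact: continuous2_log_grad.
by apply: continuous_atM => //; exact: continuous_atM.
Qed.

End Kernel.

(** * Potentials *)

Lemma near_continuous_at {R : realType} {T : topologicalType} (f g : T -> R) p :
  (\forall z \near p, f z = g z) -> {for p, continuous f} ->
  {for p, continuous g}.
Proof.
move=> fg cf; rewrite /prop_for /continuous_at -(nbhs_singleton fg).
by apply: cvg_trans cf; exact: near_eq_cvg.
Qed.

Section LayerPotential.
Context {R : realType} {n : nat}.
Variables (K U : set (pointn R n)).
Hypotheses (openK : open K) (bndK : bounded_set K) (openU : open U).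
Implicit Types (F G : pointn R n -> Cl R n) (A B : {set 'I_n}).

Definition bounded_continuousCl F :=
  forall A, bounded_continuous K (fun x => F x A).

Lemma clintE F A : clint K F A = int_on K (fun x => F x A).
Proof. by rewrite ffunE. Qed.

Lemma Cl_basisE (a : Cl R n) : a = \sum_B a B *: clbasis R B.
Proof.
apply/ffunP => A; rewrite sum_ffunE (bigD1 A)//= big1 => [|B BA].
  by rewrite addr0 clZE ffunE eqxx mulr1.
by rewrite clZE ffunE eq_sym (negbTE BA) mulr0.
Qed.

Section Linear.
Variable T : Cl R n -> Cl R n.
Hypotheses (TD : {morph T : a b / a + b}) (TZ : forall k, {morph T : a / k *: a}).

(** In finite dimension a linear map is a matrix acting on coefficients. Left multiplications, the
    hat map and Q' thereby pass through the integral by one argument. *)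
Lemma linear_basisE a A : T a A = \sum_B a B * T (clbasis R B) A.
Proof.
rewrite {1}[a]Cl_basisE (big_morph T TD (_ : T 0 = 0)).
  by rewrite sum_ffunE; apply: eq_bigr => B _; rewrite TZ clZE.
by rewrite -[X in T X](scale0r (0 : Cl R n)) TZ scale0r.
Qed.

Lemma bounded_continuousCl_linear F : bounded_continuousCl F ->
  bounded_continuousCl (fun x => T (F x)).
Proof.
move=> bF A; rewrite (_ : (fun x => T (F x) A) =
  (fun x => \sum_B F x B * T (clbasis R B) A)); last first.
  by apply/funext => x; exact: linear_basisE.
apply: bounded_continuous_sum => B.
by apply: bounded_continuousM => //; exact: bounded_continuous_cst.
Qed.

Lemma clint_linear F : bounded_continuousCl F ->
  clint K (fun x => T (F x)) = T (clint K F).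
Proof.
move=> bF; apply/ffunP => A; rewrite clintE linear_basisE.
rewrite (_ : (fun x => T (F x) A) =
  (fun x => \sum_B T (clbasis R B) A * F x B)); last first.
  by apply/funext => x; rewrite linear_basisE; apply: eq_bigr => B _; rewrite mulrC.
rewrite int_on_sum// => [|B]; last first.
  by apply: bounded_continuousM => //; exact: bounded_continuous_cst.
by apply: eq_bigr => B _; rewrite int_onZ// clintE mulrC.
Qed.

End Linear.

Lemma bounded_continuousClD F G : bounded_continuousCl F ->
  bounded_continuousCl G -> bounded_continuousCl (fun x => F x + G x).
Proof.
move=> bF bG A; rewrite (_ : (fun x => _) = fun x => F x A + G x A).
  exact: bounded_continuousD.
by apply/funext => x; rewrite clDE.
Qed.

Lemma clintD F G : bounded_continuousCl F -> bounded_continuousCl G ->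
  clint K (fun x => F x + G x) = clint K F + clint K G.
Proof.
move=> bF bG; apply/ffunP => A; rewrite clDE !clintE -int_onD//.
by congr int_on; apply/funext => x; rewrite clDE.
Qed.

Lemma bounded_continuousClB F G : bounded_continuousCl F ->
  bounded_continuousCl G -> bounded_continuousCl (fun x => F x - G x).
Proof.
move=> bF bG; apply: bounded_continuousClD => //.
by apply: (bounded_continuousCl_linear -%R) => // [a b|k a];
  rewrite ?opprD ?scalerN.
Qed.

Lemma clintB F G : bounded_continuousCl F -> bounded_continuousCl G ->
  clint K (fun x => F x - G x) = clint K F - clint K G.
Proof.
move=> bF bG; apply/ffunP => A; rewrite clDE clNE !clintE -int_onB//.
by congr int_on; apply/funext => x; rewrite clDE clNE.
Qed.

Lemma bounded_continuousCl_sum (I : finType) (F : I -> pointn R n -> Cl R n) :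
  (forall i, bounded_continuousCl (F i)) ->
  bounded_continuousCl (fun x => \sum_i F i x).
Proof.
move=> bF A; rewrite (_ : (fun x => _) = fun x => \sum_i F i x A).
  by apply: bounded_continuous_sum => i; exact: bF.
by apply/funext => x; rewrite sum_ffunE.
Qed.

Lemma clint_sum (I : finType) (F : I -> pointn R n -> Cl R n) :
  (forall i, bounded_continuousCl (F i)) ->
  clint K (fun x => \sum_i F i x) = \sum_i clint K (F i).
Proof.
move=> bF; apply/ffunP => A; rewrite sum_ffunE clintE.
transitivity (int_on K (fun x => \sum_i F i x A)).
  by congr int_on; apply/funext => x; rewrite sum_ffunE.
rewrite int_on_sum// => [|i]; last exact: bF.
by apply: eq_bigr => i _; rewrite clintE.
Qed.

Lemma clint_eq0 F : (forall x, K x -> F x = 0) -> clint K F = 0.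
Proof.
move=> F0; apply/ffunP => A; rewrite clintE [RHS]ffunE -(int_on0 K openK bndK).
rewrite /int_on; congr iint; apply/funext => c; rewrite indicE.
by case: (boolP (_ \in K)) => [/set_mem/F0 ->|_]; rewrite ?ffunE ?mulr0 ?mul0r.
Qed.

(** The vector with components [k i x y] multiplies [F x] from the left; all dependence on [y] sits
    in real factors, so scalar differentiation under the integral applies. *)
Definition layer_density (k : 'I_n -> pointn R n -> pointn R n -> R) F y x : Cl R n :=
  \sum_(i < n) k i x y *: vmul (edir R i) (F x).

Definition layer k F y : Cl R n := clint K (layer_density k F y).

Variables (k : 'I_n -> pointn R n -> pointn R n -> R) (F : pointn R n -> Cl R n).
Hypotheses (ck : forall i, jointly_continuous K U (k i)) (bF : bounded_continuousCl F).

Let bcF i A : bounded_continuous K (fun x => vmul (edir R i) (F x) A).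
Proof.
by apply: (bounded_continuousCl_linear (vmul (edir R i))) => // [a b|c a];
  rewrite ?vmulDr ?vmulZr.
Qed.

Lemma layer_densityE y x A : layer_density k F y x A =
  \sum_(i < n) k i x y * vmul (edir R i) (F x) A.
Proof. by rewrite sum_ffunE; apply: eq_bigr => i _; rewrite clZE. Qed.

Lemma layer_density_bounded y : U y -> bounded_continuousCl (layer_density k F y).
Proof.
move=> Uy A; rewrite (_ : (fun x => _) =
  fun x => \sum_(i < n) k i x y * vmul (edir R i) (F x) A).
  apply: bounded_continuous_sum => i; apply: bounded_continuousM => //.
  exact: (kernel_bounded_continuous K U).
by apply/funext => x; exact: layer_densityE.
Qed.

Lemma layerE y A : U y -> layer k F y A =
  \sum_(i < n) int_on K (fun x => k i x y * vmul (edir R i) (F x) A).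
Proof.
move=> Uy; rewrite clintE -int_on_sum//.
  by congr int_on; apply/funext => x; exact: layer_densityE.
move=> i; apply: bounded_continuousM => //.
exact: (kernel_bounded_continuous K U).
Qed.

Lemma layer_continuous y A : U y -> {for y, continuous (fun z => layer k F z A)}.
Proof.
move=> Uy; have nU : \forall z \near y, U z by exact: open_nbhs_nbhs.
apply: (near_continuous_at (fun z =>
    \sum_(i < n) int_on K (fun x => k i x z * vmul (edir R i) (F x) A))).
  by near=> z; rewrite layerE//; near: z.
apply: continuous_at_sum => i.
exact: (int_on_continuous K U openK bndK openU (k i) _ y (ck i) (bcF i A) Uy).
Unshelve. all: by end_near. Qed.

End LayerPotential.

Section LayerDerivative.
Context {R : realType} {n : nat}.
Variables (K U : set (pointn R n)).
Hypotheses (openK : open K) (bndK : bounded_set K) (openU : open U).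

Lemma layer_derive (k dk : 'I_n -> pointn R n -> pointn R n -> R)
    (F : pointn R n -> Cl R n) y v A :
  (forall i, jointly_continuous K U (k i)) ->
  (forall i, jointly_continuous K U (dk i)) ->
  (forall i x z, closure K x -> U z -> is_derive z v (k i x) (dk i x z)) ->
  bounded_continuousCl K F -> U y ->
  is_derive y v (fun z => layer K k F z A) (layer K dk F y A).
Proof.
move=> ck cdk Dk bF Uy.
have nU : \forall z \near y, U z by exact: open_nbhs_nbhs.
(* The expansion into scalar integrals is available only on the open set [U], so the derivative is
   transferred through equality near [y]. *)
have E : \forall z \near y,
    (\sum_(i < n) (fun z => int_on K (fun x => k i x z * vmul (edir R i) (F x) A))) z
    = layer K k F z A.
  by near=> z; rewrite fct_sumE (layerE K U)//; near: z.
apply: (near_eq_is_derive E).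
rewrite (layerE K U)//; apply: is_derive_sum => i.
apply: (int_on_derive K U openK bndK openU (k i) (dk i) _ y v) => //.
by apply: (bounded_continuousCl_linear K (vmul (edir R i))) => // [a b|c a];
  rewrite ?vmulDr ?vmulZr.
Unshelve. all: by end_near. Qed.

End LayerDerivative.

(** * The function I as a difference of two layer integrals *)

Section Potential.
Context {R : realType} {n : nat}.
Variables (l : 'I_n) (K : set (pointn R n)) (L : pointn R n -> Cl R n).
Hypotheses (n2 : (2 < n)%N) (lE : val l = n.-1) (openK : open K)
  (bndK : bounded_set K) (Kpos : forall x, closure K x -> 0 < lastc x)
  (bL : bounded_continuousCl K L).

Local Notation e := (edir R l).
Local Notation U := [set y : pointn R n | 0 < lastc y /\ ~ closure K y].

Lemma hatcD (a b : Cl R n) : hatc (a + b) = hatc a + hatc b.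
Proof. by apply/ffunP => C; rewrite clDE !(hatcE _ _ _ lE) clDE mulrDr. Qed.

Lemma QpD : {morph @Qp R n : a b / a + b}.
Proof.
move=> a b; rewrite !(QpE l)// hatcD -scalerDr -vmulDr; congr (_ *: vmul _ _).
by rewrite opprD addrACA.
Qed.

Lemma QpZ k : {morph @Qp R n : a / k *: a}.
Proof.
by move=> a; rewrite !(QpE l)// (hatcZ l)// -scalerBr vmulZr !scalerA mulrC.
Qed.

Let bhatL : bounded_continuousCl K (fun x => hatc (L x)).
Proof.
apply: (bounded_continuousCl_linear K (@hatc R n)) => //; first exact: hatcD.
by move=> k a; exact: (hatcZ l).
Qed.

Lemma open_exterior : open U.
Proof.
have -> : U = (fun y : pointn R n => y 0 l) @^-1` [set t | 0 < t] `&` ~` closure K.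
  by apply/seteqP; split=> y /=; rewrite (lastcE l lE).
apply: openI; last exact/closed_openC/closed_closure.
by apply: open_comp; [move=> y _; exact: coord_continuous|exact: open_gt].
Qed.

Let neqU x y : closure K x -> U y -> y != x.
Proof. by move=> Kx [_ nKy]; apply: contra_notN nKy => /eqP ->. Qed.

Let ck b i : jointly_continuous K U (kern b i).
Proof.
move=> x y Kx Uy; apply: (continuous2_kern l lE); [exact: Kpos|by case: Uy|].
exact: neqU.
Qed.

Let cdk b j i : jointly_continuous K U (dkern l b i j).
Proof.
move=> x y Kx Uy; apply: (continuous2_dkern l lE); [exact: Kpos|by case: Uy|].
exact: neqU.
Qed.

Lemma vmul_sum_edir (c : R) (w : pointn R n) (a : Cl R n) :
  \sum_(i < n) (c * w 0 i) *: vmul (edir R i) a = c *: vmul w a.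
Proof.
rewrite [in RHS](row_sum_edir w) vmul_suml scaler_sumr; apply: eq_bigr => i _.
by rewrite vmulZl scalerA.
Qed.

Lemma enormE (w : pointn R n) : enorm w = Num.sqrt (dot w w).
Proof. by rewrite /enorm; congr Num.sqrt; apply: eq_bigr => i _; rewrite expr2. Qed.

Lemma dotN (w : pointn R n) : dot (- w) (- w) = dot w w.
Proof. by apply: eq_bigr => i _; rewrite !mxE mulrNN. Qed.

Lemma enorm_sub (z y : pointn R n) : enorm (z - y) = Num.sqrt (sqdist z y).
Proof. by rewrite enormE -dotN opprB. Qed.

(** The reflection is an isometric involution, so it can be moved from y to x; this is what gives E
    and F the same weight. *)
Lemma enorm_sub_hat (x y : pointn R n) :
  enorm (x - hatv y) = Num.sqrt (sqdist (hatv x) y).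
Proof. by rewrite -enorm_sub !enormE -dot_hatv hatvB hatvK. Qed.

Lemma clvecZ (c : R) (w : pointn R n) : c *: clvec w = clvec (c *: w).
Proof.
apply/ffunP => A; rewrite clZE !ffunE mulr_sumr; apply: eq_bigr => i _.
by case: ifP; rewrite ?mxE ?mulr0.
Qed.

Lemma vinv_sub (z y : pointn R n) : vinv (z - y) = clvec (inv_vec z y).
Proof.
rewrite /vinv clvecZ enorm_sub sqr_sqrtr; last first.
  by apply: sumr_ge0 => i _; rewrite -expr2 sqr_ge0.
by congr clvec; rewrite /inv_vec scaleNr -scalerN opprB.
Qed.

Lemma kerE_density x y (a : Cl R n) : 0 < lastc y ->
  clmul (kerE x y) a = (lastc y ^+ (n - 2))^-1 *:
    \sum_(i < n) kern false i x y *: vmul (edir R i) a.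
Proof.
move=> y0; rewrite vmul_sum_edir /kerE vinv_sub clvecZ clmul_vec vmulZl scalerA.
rewrite enorm_sub_hat enorm_sub /weight mulKf ?invfM//.
by rewrite expf_neq0// gt_eqF.
Qed.

Lemma kerF_density x y (a : Cl R n) : 0 < lastc y ->
  clmul (kerF x y) a = (lastc y ^+ (n - 2))^-1 *:
    \sum_(i < n) kern true i x y *: vmul (edir R i) a.
Proof.
move=> y0; rewrite vmul_sum_edir /kerF vinv_sub clvecZ clmul_vec vmulZl scalerA.
rewrite !enorm_sub /weight mulKf ?invfM//.
by rewrite expf_neq0// gt_eqF.
Qed.

Definition potential y : Cl R n :=
  layer K (kern false) L y - layer K (kern true) (fun x => hatc (L x)) y.

Definition dpotential j y : Cl R n :=
  layer K (fun i => dkern l false i j) L y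
  - layer K (fun i => dkern l true i j) (fun x => hatc (L x)) y.

Lemma Ifun_potential y : U y -> Ifun K L y = potential y.
Proof.
move=> Uy; have [y0 _] := Uy; rewrite /Ifun /potential /layer.
have pull b F : bounded_continuousCl K F -> clint K (fun x =>
    (lastc y ^+ (n - 2))^-1 *: layer_density (kern b) F y x) =
    (lastc y ^+ (n - 2))^-1 *: clint K (layer_density (kern b) F y).
  move=> bF; apply: (clint_linear K openK bndK (fun a => _ *: a)).
  - by move=> a c; rewrite scalerDr.
  - by move=> k a; rewrite !scalerA mulrC.
  - exact: (layer_density_bounded K U).
have -> : (fun x => clmul (kerE x y) (L x)) = (fun x =>
    (lastc y ^+ (n - 2))^-1 *: layer_density (kern false) L y x).
  by apply/funext => x; exact: kerE_density.
have -> : (fun x => clmul (kerF x y) (hatc (L x))) = (fun x =>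
    (lastc y ^+ (n - 2))^-1 *: layer_density (kern true) (fun x => hatc (L x)) y x).
  by apply/funext => x; exact: kerF_density.
rewrite !pull// -scalerBr scalerA mulfV ?scale1r//.
by rewrite expf_neq0// gt_eqF.
Qed.

Lemma near_exterior y : U y -> \forall z \near y, U z.
Proof. by move=> Uy; apply: open_nbhs_nbhs; split => //; exact: open_exterior. Qed.

Lemma potential_derive y j A : U y ->
  is_derive y (edir R j) (fun z => potential z A) (dpotential j y A).
Proof.
move=> Uy; rewrite /potential /dpotential clDE clNE.
rewrite (_ : (fun z => _) = (fun z => layer K (kern false) L z A)
    - (fun z => layer K (kern true) (fun x => hatc (L x)) z A)); last first.
  by apply/funext => z; rewrite clDE clNE.
have n1 : (1 < n)%N by exact: ltnW.
apply: is_deriveB; apply: (layer_derive K U openK bndK open_exterior) => // i x z Kx Uz;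
  by apply: (is_derive_kern l lE) => //; [exact: Kpos|case: Uz|exact: neqU].
Qed.

Lemma potential_continuous y A : U y -> {for y, continuous (fun z => potential z A)}.
Proof.
move=> Uy; apply: (continuous_at_ext (fun z => layer K (kern false) L z A
    - layer K (kern true) (fun x => hatc (L x)) z A)).
  by move=> z; rewrite /potential clDE clNE.
by apply: continuous_atB; exact: (layer_continuous K U openK bndK open_exterior).
Qed.

Lemma dpotential_continuous y j A : U y ->
  {for y, continuous (fun z => dpotential j z A)}.
Proof.
move=> Uy; apply: (continuous_at_ext (fun z => layer K (fun i => dkern l false i j) L z A
    - layer K (fun i => dkern l true i j) (fun x => hatc (L x)) z A)).
  by move=> z; rewrite /dpotential clDE clNE.
by apply: continuous_atB; apply: (layer_continuous K U openK bndK open_exterior) => // i.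
Qed.

(** Each term is a linear operator applied to an integral, so the whole expression becomes the
    integral of a single density, and that density vanishes at every point of [K]. *)
Lemma dirac_hodge_potential y : U y ->
  \sum_(j < n) vmul (edir R j) (dpotential j y)
  + ((n%:R - 2) / lastc y) *: Qp (potential y) = 0.
Proof.
move=> Uy; have [y0 _] := Uy.
pose D j x := layer_density (fun i => dkern l false i j) L y x
  - layer_density (fun i => dkern l true i j) (fun x => hatc (L x)) y x.
pose G x := layer_density (kern false) L y x
  - layer_density (kern true) (fun x => hatc (L x)) y x.
have bD j : bounded_continuousCl K (D j).
  by apply: bounded_continuousClB => //; apply: (layer_density_bounded K U) => // i.
have bG : bounded_continuousCl K G.
  by apply: bounded_continuousClB => //; apply: (layer_density_bounded K U).
have -> : potential y = clint K G.
  by rewrite clintB//; exact: (layer_density_bounded K U).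
have -> : \sum_(j < n) vmul (edir R j) (dpotential j y) =
    \sum_(j < n) clint K (fun x => vmul (edir R j) (D j x)).
  apply: eq_bigr => j _; rewrite (clint_linear K openK bndK (vmul (edir R j)))//.
  - by rewrite clintB//; apply: (layer_density_bounded K U) => // i.
  - exact: vmulDr.
  - by move=> k a; exact: vmulZr.
have bvD j : bounded_continuousCl K (fun x => vmul (edir R j) (D j x)).
  apply: (bounded_continuousCl_linear K (vmul (edir R j))) => //.
    exact: vmulDr.
  by move=> k a; exact: vmulZr.
have QlD : {morph (fun a : Cl R n => ((n%:R - 2) / lastc y) *: Qp a) : a b / a + b}.
  by move=> a b; rewrite QpD scalerDr.
have QlZ k : {morph (fun a : Cl R n => ((n%:R - 2) / lastc y) *: Qp a) : a / k *: a}.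
  by move=> a; rewrite QpZ !scalerA mulrC.
rewrite -(clint_sum K openK bndK)// -(clint_linear K openK bndK _ QlD QlZ)// -clintD//.
- apply: clint_eq0 => // x Kx; have cKx := subset_closure Kx.
  have yx := neqU _ _ cKx Uy; have x0 := Kpos _ cKx.
  rewrite /D /G /layer_density !vmul_sum_edir -scalerBr.
  (* With X = y - x and V = y - hat x, the difference X - hat V equals y - hat y = 2 y_n e_n. *)
  apply: (dirac_hodge_kernel l lE (y - x) (y - hatv x) (lastc y)).
  + rewrite hatvB hatvK opprB addrA subrK; apply/rowP => i.
    rewrite (lastcE l lE) [RHS]mxE edirE [LHS]mxE [(- hatv y) 0 i]mxE (hatvE _ _ _ lE).
    by rewrite eq_sym; case: eqP => [->|_] /=; ring.
  + by rewrite gt_eqF// sqdist_gt0.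
  + by rewrite gt_eqF//; apply: (sqdist_gt0 (hatv x)); exact: (pole_neq l lE true).
  + by rewrite gt_eqF.
- by apply: bounded_continuousCl_sum.
- exact: (bounded_continuousCl_linear K _ QlD QlZ).
Qed.

Lemma Ifun_derive y j A : U y ->
  is_derive y (edir R j) (fun z => Ifun K L z A) (dpotential j y A).
Proof.
move=> Uy; apply: near_eq_is_derive (potential_derive y j A Uy).
by apply: filterS (near_exterior _ Uy) => z Uz; rewrite Ifun_potential.
Qed.

Lemma Ifun_hypermonogenic : hypermonogenic U (Ifun K L).
Proof.
split=> [A|y Uy]; last first.
  rewrite /Mop Ifun_potential// -[RHS](dirac_hodge_potential y Uy); congr (_ + _).
  apply: eq_bigr => j _; rewrite clmul_vec; congr vmul.
  by apply/ffunP => A; rewrite ffunE; have [_ ->] := Ifun_derive y j A Uy.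
split=> [y Uy|j].
  apply: near_continuous_at (potential_continuous y A Uy).
  by apply: filterS (near_exterior _ Uy) => z Uz; rewrite Ifun_potential.
split=> [y Uy|]; first by have [] := Ifun_derive y j A Uy.
(* The derivative is identified with [dpotential] throughout a neighbourhood, as its continuity at
   [y] requires. *)
split=> // y Uy; apply: near_continuous_at (dpotential_continuous y j A Uy).
by apply: filterS (near_exterior _ Uy) => z Uz; have [_ ->] := Ifun_derive z j A Uz.
Qed.

End Potential.

(** Continuity on the compact closure gives the bound; on the open set [K], relative continuity is
    continuity in the ambient space. *)
Lemma C1_closure_bounded_continuous {R : realType} {n : nat}
    (K : set (pointn R n)) (L : pointn R n -> Cl R n) :
  open K -> bounded_set K -> C1_closure K L -> bounded_continuousCl K L.
Proof.
move=> openK bndK cL A; have [cA _] := cL A; split.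
  have /compact_bounded[M [_ MP]] := continuous_compact cA (compact_closure K bndK).
  exists (M + 1) => x Kx; apply: (MP (M + 1)); first by rewrite ltrDl.
  by exists x => //; exact: subset_closure.
have := continuous_subspaceW (@subset_closure _ K) cA.
by rewrite continuous_open_subspace// => H x Kx; apply: H; exact: mem_set.
Qed.

Theorem theorem13 (R : realType) (n : nat) (K : set (pointn R n))
  (L : pointn R n -> Cl R n) :
  (2 < n)%N ->
  smooth_bounded_region K ->
  (forall x, closure K x -> 0 < lastc x) ->
  C1_closure K L ->
  hypermonogenic [set y | 0 < lastc y /\ ~ closure K y] (Ifun K L).
Proof.
move=> n2 [openK _ _ bndK _] Kpos cL.
have n1 : (n.-1 < n)%N by rewrite prednK// (ltn_trans _ n2).
apply: (Ifun_hypermonogenic (Ordinal n1)) => //.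
exact: C1_closure_bounded_continuous.
Qed.
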